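(* For semi-density matrices $\sigma$, $\rho$ on $n$ qubits, relativized to elementary $\rho$ and an elementary POVM $E$, $\mathbf{d}(E\sigma|E\rho)<^{+}\mathbf{d}(\sigma|\rho)$.
   Context: $U$ is a fixed universal prefix Turing machine and $\mathbf{m}(x/y)=\sum_p 2^{-\|p\|}[U_y(p)=x]$ the universal probability. An object is elementary if its entries have rational real and imaginary parts. A POVM $E$ is a finite or infinite set of positive matrices $\{E_k\}$ with $\sum_kE_k=I$; it is elementary if some program enumerates $\{E_k\}$ with each $E_k$ elementary. For semi-density $\sigma$, $E\sigma$ is the semimeasure on integers $E\sigma(k)=\mathrm{Tr}\,E_k\sigma$. For a semimeasure $\gamma$ and computable probability measure $P$, the classical deficiency of randomness is $\mathbf{d}(\gamma|P)=\log\sum_x\gamma(x)\mathbf{m}(x)/P(x)$. For matrices: a program $q$ lower computes a positive semidefinite matrix $\nu$ if $U(q)$ outputs an increasing sequence of elementary semi-density matrices converging to $\nu$; $\underline{\mathbf{m}}(\nu/x)=\sum\{\mathbf{m}(q/x): q\text{ lower computes }\nu\}$; $\mathcal{T}_\rho$ is the set of lower computable $\nu$ with $\mathrm{Tr}\,\nu\rho\le1$; $\mathfrak{T}_\rho=\sum_{\nu\in\mathcal{T}_\rho}\underline{\mathbf{m}}(\nu/n)\nu$; and the quantum deficiency of randomness is $\mathbf{d}(\sigma|\rho)=\log\mathrm{Tr}\,\mathfrak{T}_\rho\sigma$. $f<^{+}g$ means $f<g+O(1)$; ''relativized to'' means these objects are given to $U$ on an auxiliary tape.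
   Formalization: In ''q lower computes ν'' the increasing elementary matrices are required to be positive semidefinite but not of trace at most 1; with the semi-density bound, d(σ|ρ) ≤ 0 always and the claim fails, e.g. for ρ = 2^{-n}I, σ = |0><0| and the computational-basis measurement. *)

(* Defs.v *)
From HB Require Import structures.
From mathcomp Require Import all_boot all_order all_algebra.
From mathcomp Require Import all_classical all_reals all_analysis.
From mathcomp Require Import complex.

Set Implicit Arguments.
Unset Strict Implicit.
Unset Printing Implicit Defensive.

Import Order.TTheory GRing.Theory Num.Theory.
Import numFieldNormedType.Exports.
Local Open Scope classical_set_scope.
Local Open Scope ring_scope.

(* A deterministic machine with finite control, finitely many read-write work
   tapes, a one-way read-only binary program tape, a two-way read-only auxiliary
   tape and a one-way write-only binary output tape.  Work and auxiliary tapes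
   are infinite to the right only; moving left from cell 0 stays there. *)

Inductive move := MLeft | MStay | MRight.

Definition do_move (d : move) (i : nat) : nat :=
  match d with MLeft => i.-1 | MStay => i | MRight => i.+1 end.

Record action (Q W G : Type) := Action {
  act_state : Q;
  act_work : W -> G * move;
  act_aux : move;
  act_out : option bool
}.

(* In a state of [reading], a step consumes the next program bit [b], passed to
   the transition function as [Some b]; in the other states the program tape is
   untouched and the transition function receives [None].  The second
   [option bool] is the auxiliary cell scanned, [None] being blank. *)
Record machine := Machine {
  mstate : finType;
  mwork : finType;
  msym : finType;
  mblank : msym;
  mstart : mstate;
  mhalt : pred mstate;
  reading : pred mstate;
  mtrans : mstate -> option bool -> option bool -> {ffun mwork -> msym} ->
           action mstate mwork msym
}.

Record config (M : machine) := Config {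
  cstate : mstate M;
  cprog : seq bool;                     (* program bits not yet read *)
  caux : nat;
  cwork : mwork M -> nat -> msym M;
  cpos : mwork M -> nat;
  cout : seq bool
}.

(* A finite string or an infinite sequence of bits followed by blanks. *)
Definition auxtape := nat -> option bool.

Definition blank_tape : auxtape := fun=> None.

Definition exec (M : machine) (y : auxtape) (c : config M) (b : option bool)
    (rest : seq bool) : config M :=
  let a := mtrans (cstate c) b (y (caux c))
             [ffun w => cwork c w (cpos c w)] in
  Config (act_state a) rest (do_move (act_aux a) (caux c))
    (fun w i => if i == cpos c w then (act_work a w).1 else cwork c w i)
    (fun w => do_move (act_work a w).2 (cpos c w))
    (if act_out a is Some o then rcons (cout c) o else cout c).

(* A reading state with no program bit left is blocked forever. *)
Definition step (M : machine) (y : auxtape) (c : config M) : config M :=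
  if mhalt (cstate c) then c
  else if reading (cstate c) then
    if cprog c is b :: s then exec y c (Some b) s else c
  else exec y c None (cprog c).

Definition init (M : machine) (p : seq bool) : config M :=
  Config (mstart M) p 0%N (fun _ _ => mblank M) (fun=> 0%N) [::].

Definition run (M : machine) (y : auxtape) (p : seq bool) (t : nat) : config M :=
  iter t (step y) (init M p).

(* [M_y(p) = x]: M halts with output x after reading exactly the bits of p, so
   that for every y the domain of [M_y] is prefix-free. *)
Definition computes (M : machine) (y : auxtape) (p x : seq bool) : Prop :=
  exists t, [/\ mhalt (cstate (run M y p t)), cprog (run M y p t) = [::]
              & cout (run M y p t) = x].

(* s is an initial segment of what M, halting or not, writes on its output tape
   when it is given the program p. *)
Definition emits (M : machine) (y : auxtape) (p s : seq bool) : Prop :=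
  exists t, prefix s (cout (run M y p t)).

Definition universal (U : machine) : Prop :=
  forall M : machine, exists w : seq bool, forall (y : auxtape) (p : seq bool),
    (forall x, computes U y (w ++ p) x <-> computes M y p x) /\
    (forall s, emits U y (w ++ p) s <-> emits M y p s).

(* Real and imaginary parts of a matrix on n qubits with entries in Q(i). *)
Definition emx (n : nat) : Type := ('M[rat]_(2 ^ n) * 'M[rat]_(2 ^ n))%type.

Definition emx_val (R : realType) (n : nat) (A : emx n) : 'M[R[i]]_(2 ^ n) :=
  \matrix_(i, j) Complex (ratr (A.1 i j)) (ratr (A.2 i j)).

(* Any other computable injective encoding would change the quantities below
   only by constant factors. *)
Definition enc_nat (k : nat) : seq bool := rcons (nseq k true) false.
Definition enc_int (z : int) : seq bool := (z < 0) :: enc_nat `|z|%N.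
Definition enc_rat (q : rat) : seq bool :=
  enc_int (numq q) ++ enc_nat `|denq q|%N.
Definition enc_emx (n : nat) (A : emx n) : seq bool :=
  enc_nat n ++
  flatten [seq enc_rat (A.1 i j) ++ enc_rat (A.2 i j)
          | i <- enum 'I_(2 ^ n), j <- enum 'I_(2 ^ n)].

(* Families {E_k} are indexed by k < K when the length is [Some K], and by all
   of nat when it is [None]. *)
Definition in_len (K : option nat) (k : nat) : bool :=
  if K is Some K' then (k < K')%N else true.

Definition enc_first (n : nat) (K : option nat) (E : nat -> emx n) (k : nat) :
    seq bool :=
  flatten [seq enc_emx (E j) | j <- iota 0 k & in_len K j].

(* The program p makes M write exactly the sequence E on its output tape. *)
Definition enumerates (M : machine) (y : auxtape) (p : seq bool) (n : nat)
    (K : option nat) (E : nat -> emx n) : Prop :=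
  (forall k, emits M y p (enc_first K E k)) /\
  (forall s, emits M y p s -> exists k, prefix s (enc_first K E k)).

(* The auxiliary tape holding rho followed by E_0, E_1, ...; every block is
   nonempty, so i.+1 blocks determine cell i. *)
Definition rel_tape (n : nat) (rho : emx n) (K : option nat) (E : nat -> emx n) :
    auxtape :=
  fun i => onth (enc_emx rho ++ enc_first K E i.+1) i.

Definition cond_tape (k : nat) (y : auxtape) : auxtape :=
  fun i => if (i < size (enc_nat k))%N then onth (enc_nat k) i
           else y (i - size (enc_nat k))%N.

Definition psd (R : realType) (N : nat) (A : 'M[R[i]]_N) : Prop :=
  map_mx Num.conj A^T = A /\
  forall v : 'cV[R[i]]_N, 0 <= (map_mx Num.conj v^T *m A *m v) 0 0.

Definition loewner_le (R : realType) (N : nat) (A B : 'M[R[i]]_N) : Prop :=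
  psd (B - A).

Definition semi_density (R : realType) (N : nat) (A : 'M[R[i]]_N) : Prop :=
  psd A /\ \tr A <= 1.

Definition mx_cvg (R : realType) (N : nat) (A : nat -> 'M[R[i]]_N)
    (B : 'M[R[i]]_N) : Prop :=
  forall i j,
    (fun t : nat => complex.Re (A t i j)) @ \oo --> complex.Re (B i j) /\
    (fun t : nat => complex.Im (A t i j)) @ \oo --> complex.Im (B i j).

Definition povm (R : realType) (N : nat) (K : option nat)
    (E : nat -> 'M[R[i]]_N) : Prop :=
  (forall k, in_len K k -> psd (E k)) /\
  mx_cvg (fun t => \sum_(k < t | in_len K k) E k) 1%:M.

Definition elementary_povm (R : realType) (U : machine) (n : nat)
    (K : option nat) (E : nat -> emx n) : Prop :=
  povm K (fun k => emx_val R (E k)) /\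
  exists p, enumerates U blank_tape p K E.

Definition povm_semimeasure (R : realType) (n : nat) (K : option nat)
    (E : nat -> emx n) (sigma : 'M[R[i]]_(2 ^ n)) (k : nat) : R :=
  if in_len K k then complex.Re (\tr (emx_val R (E k) *m sigma)) else 0.

Local Open Scope ereal_scope.

Definition log2e (R : realType) (x : \bar R) : \bar R :=
  lne x * ((ln 2)^-1)%:E.

Definition univ_prob (R : realType) (U : machine) (y : auxtape) (x : seq bool) :
    \bar R :=
  \esum_(p in [set p | computes U y p x]) ((2^-1 : R) ^+ size p)%:E.

(* Since [0^-1 = +oo] and [0 * +oo = 0] in [\bar R], an outcome of P-measure 0
   contributes 0 if its gamma-measure is also 0, and +oo otherwise. *)
Definition classical_deficiency (R : realType) (U : machine) (y : auxtape)
    (gamma P : nat -> R) : \bar R :=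
  log2e (\esum_(x in [set: nat])
           ((gamma x)%:E * univ_prob R U y (enc_nat x) * ((P x)%:E)^-1)).

(* The elementary approximations are positive semidefinite of arbitrary trace:
   under the bound [\tr <= 1] every lower computable matrix would meet the
   condition [\tr (nu *m rho) <= 1] defining the tests below. *)
Definition lower_computes (R : realType) (U : machine) (y : auxtape) (n : nat)
    (q : seq bool) (nu : 'M[R[i]]_(2 ^ n)) : Prop :=
  exists A : nat -> emx n,
    [/\ forall t, psd (emx_val R (A t)),
        forall t, loewner_le (emx_val R (A t)) (emx_val R (A t.+1)),
        mx_cvg (fun t => emx_val R (A t)) nu
      & enumerates U y q None A].

(* U runs q with auxiliary tape y, while the probability of q is taken
   conditionally on x, i.e. with x added to y. *)
Definition mx_prob (R : realType) (U : machine) (y : auxtape) (n : nat)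
    (nu : 'M[R[i]]_(2 ^ n)) (x : nat) : \bar R :=
  \esum_(q in [set q | lower_computes U y q nu])
     univ_prob R U (cond_tape x y) q.

Definition tests (R : realType) (U : machine) (y : auxtape) (n : nat)
    (rho : 'M[R[i]]_(2 ^ n)) : set 'M[R[i]]_(2 ^ n) :=
  [set nu | (exists q, lower_computes U y q nu) /\ (\tr (nu *m rho) <= 1)%R].

(* The trace of (the weighted sum of all tests) * sigma.  It is summed in
   [\bar R] because the matrix sum can diverge when rho is singular. *)
Definition tr_univ_test (R : realType) (U : machine) (y : auxtape) (n : nat)
    (rho sigma : 'M[R[i]]_(2 ^ n)) : \bar R :=
  \esum_(nu in tests U y rho)
     (mx_prob U y nu n * (complex.Re (\tr (nu *m sigma)))%:E).

Definition quantum_deficiency (R : realType) (U : machine) (y : auxtape)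
    (n : nat) (sigma rho : 'M[R[i]]_(2 ^ n)) : \bar R :=
  log2e (tr_univ_test U y rho sigma).

(* Main.v *)
(* For each outcome k, the matrix nu = E_k / Tr(E_k rho) is a test for rho, and it is computed
   exactly by one fixed machine from k and the auxiliary tape.  A second machine turns any
   program computing k into one printing the program of nu, so the universal probability of
   the latter is at least a constant times m(k).  Summing over k bounds the classical sum by
   a constant times Tr(T_rho sigma).  If Tr(E_k rho) = 0, every 2^j E_k is a test, of weight
   at least a constant times 2^-j m(k), and the sum over j diverges as soon as
   Tr(E_k sigma) > 0 and m(k) > 0.

   As rho is Hermitian, Tr(E_k rho) is the dot product of the two lists of rational entries, in the
   order in which they are written on the tape, and a machine with counters suffices. *)

Require Import Defs.
From HB Require Import structures.
From mathcomp Require Import all_boot all_order all_algebra.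
From mathcomp Require Import all_classical all_reals all_analysis.
From mathcomp Require Import complex ring.

Set Implicit Arguments.
Unset Strict Implicit.
Unset Printing Implicit Defensive.

Import Order.TTheory GRing.Theory Num.Theory.

(** * Counter machines *)

(** The constant must be uniform in [n], [rho] and [E], so all that varies is read from the tapes,
    and only two machines enter: [scaled_povm], with prefix [w1], and a relay with [w1] built into
    its control, with prefix [w2]; both prefixes depend on [U] alone. The definitions shape these
    machines. A lower computation has to write each rational in the canonical form of [enc_rat], so
    rescaled entries must be brought to lowest terms; the trace with [rho] being rational, the
    approximating sequence can be constant. The weight of a program of [nu] is conditional on [n],
    i.e. taken on a tape with [enc_nat n] in front, whereas [k] is computed on the tape without it:
    the relay has to simulate [U] on a shifted tape. Every program carries a [j], even when the
    trace is positive and [j] is ignored; [j = 0] is then used, and its single bit is the 1 in the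
    constant [size w2 + 1]. Finally, tests are counted together with their programs: distinct pairs
    [(k, j)] have distinct programs even where the matrices coincide, so no weight is used twice. *)

Section Counter.
Variable W : finType.

Record primact := PrimAct {
  pa_again : bool;
  pa_move : W -> move;
  pa_aux : move;
  pa_out : option bool
}.

(* [Prim rd f] is a single control location, left when [pa_again] is false; [rd] tells
   whether it consumes a program bit.  [f] sees which counters are zero. *)
Inductive cmd :=
| Prim of bool & (option bool -> option bool -> (W -> bool) -> primact)
| Seq of cmd & cmd
| While of W & cmd.

(** The extra location [None] of a loop is the one where its counter is tested. *)
Fixpoint loc (c : cmd) : finType :=
  match c with
  | Prim _ _ => unit : finType
  | Seq a b => (loc a + loc b)%type : finType
  | While _ a => option (loc a) : finType
  end.

Fixpoint entry (c : cmd) : loc c :=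
  match c with
  | Prim _ _ => tt
  | Seq a b => inl (entry a)
  | While _ _ => None
  end.

Fixpoint loc_reads (c : cmd) : loc c -> bool :=
  match c return loc c -> bool with
  | Prim rd _ => fun=> rd
  | Seq a b => fun q => match q with inl q => loc_reads q | inr q => loc_reads q end
  | While _ a => fun q => if q is Some q then loc_reads q else false
  end.

Record transition (Q : Type) := Transition {
  tr_loc : option Q;
  tr_move : W -> move;
  tr_aux : move;
  tr_out : option bool
}.

Definition tr_map (Q Q' : Type) (h : option Q -> option Q') (a : transition Q) :=
  Transition (h (tr_loc a)) (tr_move a) (tr_aux a) (tr_out a).

Fixpoint loc_trans (c : cmd) : loc c -> option bool -> option bool ->
    (W -> bool) -> transition (loc c) :=
  match c return loc c -> option bool -> option bool -> (W -> bool) ->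
    transition (loc c) with
  | Prim _ f => fun q b s z =>
      let a := f b s z in
      @Transition unit (if pa_again a then Some tt else None) (pa_move a) (pa_aux a)
        (pa_out a)
  | Seq a b => fun q p s z =>
      match q with
      | inl q => tr_map (fun o => if o is Some q' then Some (inl q')
                                  else Some (inr (entry b)))
                   (loc_trans q p s z)
      | inr q => tr_map (omap inr) (loc_trans q p s z)
      end
  | While x a => fun q p s z =>
      match q with
      | Some q => tr_map Some (loc_trans q p s z)
      | None => Transition (if z x then None else Some (Some (entry a)))
                  (fun=> MStay) MStay None
      end
  end.

Record state := State {
  regs : W -> nat;
  auxpos : nat;
  input : seq bool;
  output : seq bool
}.

Variable y : auxtape.

Definition do_trans (Q : Type) (s : state) (rest : seq bool) (a : transition Q) :
    option Q * state :=
  (tr_loc a,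
   State (fun w => do_move (tr_move a w) (regs s w))
     (do_move (tr_aux a) (auxpos s)) rest
     (if tr_out a is Some o then rcons (output s) o else output s)).

Definition loc_step (c : cmd) (q : loc c) (s : state) :
    option (option (loc c) * state) :=
  let z w := regs s w == 0 in
  if loc_reads q then
    if input s is b :: r then
      Some (do_trans s r (loc_trans q (Some b) (y (auxpos s)) z))
    else None
  else Some (do_trans s (input s) (loc_trans q None (y (auxpos s)) z)).

(** [None] as target means that the command has been left. Runs that end at an inner location are
    needed too: a machine that prints for ever is described by its returns to a loop test. *)
Inductive reach (c : cmd) : loc c -> state -> option (loc c) -> state -> Prop :=
| reach_step q s o s' : loc_step q s = Some (o, s') -> reach q s o s'
| reach_trans q s q1 s1 o s' :
    loc_step q s = Some (Some q1, s1) -> reach q1 s1 o s' -> reach q s o s'.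

Definition runs (c : cmd) (s s' : state) : Prop := reach (entry c) s None s'.

Lemma reach_cat (c : cmd) (q q1 : loc c) (s s1 s' : state) o :
  reach q s (Some q1) s1 -> reach q1 s1 o s' -> reach q s o s'.
Proof.
move Eo: (Some q1) => o1 H; elim: H Eo => [q2 s2 o2 s3 E Eo Hc|q2 s2 q3 s3 o2 s4 E _ IH Eo Hc].
  by rewrite -Eo in E; exact: reach_trans E Hc.
exact: (reach_trans E (IH Eo Hc)).
Qed.

Lemma loc_step_inl (a b : cmd) (q : loc a) s o s' :
  loc_step q s = Some (o, s') ->
  @loc_step (Seq a b) (inl q) s =
    Some (if o is Some q' then Some (inl q') else Some (inr (entry b)), s').
Proof.
rewrite /loc_step /=; case: ifP => _; last by case=> <- <-.
by case: (input s) => // x r [<- <-].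
Qed.

Lemma loc_step_inr (a b : cmd) (q : loc b) s o s' :
  loc_step q s = Some (o, s') ->
  @loc_step (Seq a b) (inr q) s = Some (omap inr o, s').
Proof.
rewrite /loc_step /=; case: ifP => _; last by case=> <- <-.
by case: (input s) => // x r [<- <-].
Qed.

Lemma loc_step_body x (a : cmd) (q : loc a) s o s' :
  loc_step q s = Some (o, s') ->
  @loc_step (While x a) (Some q) s = Some (Some o, s').
Proof.
rewrite /loc_step /=; case: ifP => _; last by case=> <- <-.
by case: (input s) => // z r [<- <-].
Qed.

Lemma reach_inl (a b : cmd) (q : loc a) s o s' :
  reach q s o s' ->
  @reach (Seq a b) (inl q) s
    (if o is Some q' then Some (inl q') else Some (inr (entry b))) s'.
Proof.
elim=> [{}q {}s {}o {}s' E|{}q {}s q1 s1 {}o {}s' E _ IH].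
  by apply: reach_step; exact: loc_step_inl E.
exact: (reach_trans (loc_step_inl b E)).
Qed.

Lemma reach_inr (a b : cmd) (q : loc b) s o s' :
  reach q s o s' -> @reach (Seq a b) (inr q) s (omap inr o) s'.
Proof.
elim=> [{}q {}s {}o {}s' E|{}q {}s q1 s1 {}o {}s' E _ IH].
  by apply: reach_step; exact: loc_step_inr E.
exact: (reach_trans (loc_step_inr a E)).
Qed.

Lemma reach_body x (a : cmd) (q : loc a) s o s' :
  reach q s o s' -> @reach (While x a) (Some q) s (Some o) s'.
Proof.
elim=> [{}q {}s {}o {}s' E|{}q {}s q1 s1 {}o {}s' E _ IH].
  by apply: reach_step; exact: loc_step_body E.
exact: (reach_trans (loc_step_body x E)).
Qed.

Lemma runs_seq (a b : cmd) s s1 s' :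
  runs a s s1 -> runs b s1 s' -> runs (Seq a b) s s'.
Proof. by move=> /(reach_inl b) Ha /(reach_inr a) Hb; exact: reach_cat Ha Hb. Qed.

Lemma do_trans_id (Q : Type) (s : state) (o : option Q) :
  do_trans s (input s) (Transition o (fun=> MStay) MStay None) = (o, s).
Proof. by case: s. Qed.

Lemma runs_while0 x (a : cmd) s : regs s x = 0 -> runs (While x a) s s.
Proof.
by move=> z; apply: reach_step; rewrite /loc_step /= z eqxx do_trans_id.
Qed.

Lemma reach_while x (a : cmd) s s' :
  regs s x != 0 -> runs a s s' -> @reach (While x a) None s (Some None) s'.
Proof.
move=> /negPf z /(reach_body x); apply: reach_trans.
by rewrite /loc_step /= z do_trans_id.
Qed.

Lemma runs_while x (a : cmd) s s1 s' :
  regs s x != 0 -> runs a s s1 -> runs (While x a) s1 s' -> runs (While x a) s s'.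
Proof. by move=> z /(reach_while z); exact: reach_cat. Qed.

(* A counter is the head position of a work tape whose cell 0 alone carries the symbol
   [true]; the start state [None] writes these marks. *)
Definition machine_of (c : cmd) : machine :=
  @Machine (option (option (loc c))) W bool false None
    (pred1 (Some None))
    (fun q => if q is Some (Some q) then loc_reads q else false)
    (fun q p s g =>
       match q with
       | None => Action (Some (Some (entry c))) (fun=> (true, MStay)) MStay None
       | Some None => Action (Some None) (fun=> (true, MStay)) MStay None
       | Some (Some q) =>
           let a := loc_trans q p s (fun w => g w) in
           Action (Some (tr_loc a)) (fun w => (g w, tr_move a w)) (tr_aux a) (tr_out a)
       end).

Definition conf (c : cmd) (o : option (loc c)) (s : state) : config (machine_of c) :=
  @Config (machine_of c) (Some o) (input s) (auxpos s) (fun _ i => i == 0) (regs s)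
    (output s).

Lemma exec_conf (c : cmd) (q : loc c) (s : state) b r :
  exec y (conf (Some q) s) b r =
  let a := do_trans s r (loc_trans q b (y (auxpos s)) (fun w => regs s w == 0)) in
  conf a.1 a.2.
Proof.
rewrite /exec /conf /do_trans /=.
have -> : (fun w => [ffun w0 => regs s w0 == 0] w) = (fun w => regs s w == 0).
  by apply: funext => w; rewrite ffunE.
congr (Config _ _ _ _ _ _).
by apply: funext => w; apply: funext => i; rewrite ffunE; case: eqP => // ->.
Qed.

Lemma step_conf (c : cmd) (q : loc c) (s : state) o s' :
  loc_step q s = Some (o, s') -> step y (conf (Some q) s) = conf o s'.
Proof.
rewrite /loc_step /step /=; case: ifP => _; last by rewrite exec_conf /= => -[-> ->].
by case: (input s) => // b r; rewrite exec_conf /= => -[-> ->].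
Qed.

Lemma reach_conf (c : cmd) (q : loc c) (s : state) o s' :
  reach q s o s' -> exists t, iter t (step y) (conf (Some q) s) = conf o s'.
Proof.
elim=> [{}q {}s {}o {}s' E|{}q {}s q1 s1 {}o {}s' E _ [t IH]].
  by exists 1; exact: step_conf.
by exists t.+1; rewrite iterSr (step_conf E).
Qed.

Definition start_state (p : seq bool) := State (fun=> 0) 0 p [::].

Lemma run_start (c : cmd) p :
  run (machine_of c) y p 1 = conf (Some (entry c)) (start_state p).
Proof.
rewrite /run /= /step /= /exec /=.
by congr Config; apply: funext => w; apply: funext => i; case: eqP.
Qed.

Lemma reach_run (c : cmd) p o s :
  reach (entry c) (start_state p) o s ->
  exists t, run (machine_of c) y p t = conf o s.
Proof.
move=> /reach_conf[t E]; exists (t + 1).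
by rewrite /run iterD -/(run _ _ _ 1) run_start.
Qed.

End Counter.

(** * Growth of the output tape *)

Section Output.
Variables (M : machine) (y : auxtape) (p : seq bool).

Lemma step_out (c : config M) :
  prefix (cout c) (cout (step y c)) /\ size (cout (step y c)) <= (size (cout c)).+1.
Proof.
rewrite /step; case: ifP => _; first by rewrite prefix_refl leqnSn.
have H b r : prefix (cout c) (cout (exec y c b r)) /\
    size (cout (exec y c b r)) <= (size (cout c)).+1.
  rewrite /exec /=; case: act_out => [bit |]; last by rewrite prefix_refl leqnSn.
  by rewrite size_rcons leqnn prefix_rcons.
case: ifP => _; last exact: H.
by case: (cprog c) => [|b r]; [rewrite prefix_refl leqnSn | exact: H].
Qed.

Lemma run_out_prefix t t' : t <= t' ->
  prefix (cout (run M y p t)) (cout (run M y p t')).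
Proof.
move=> /subnK <-; elim: (t' - t) => [|d IH]; first exact: prefix_refl.
rewrite addSn; apply: prefix_trans IH _; rewrite /run iterS.
by case: (step_out (iter (d + t) (step y) (init M p))).
Qed.

Lemma run_out_size t : size (cout (run M y p t)) <= t.
Proof.
elim: t => // t IH; rewrite /run iterS.
by apply: leq_trans (proj2 (step_out _)) _; rewrite ltnS.
Qed.

End Output.

(** A step writes at most one bit, so [k <= size (g k)] forces the loop test with output [g k] to be
    reached no earlier than time [k]. Hence whatever is written by time [t] is a prefix of [g t]. *)
Lemma emits_loop (W : finType) (a b : cmd W) (x : W) (y : auxtape) (p : seq bool)
    (s : state W) (g : nat -> seq bool) :
  let st k := State (regs s) (auxpos s) (input s) (g k) in
  runs y a (start_state W p) (st 0) -> regs s x != 0 ->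
  (forall k, runs y b (st k) (st k.+1)) ->
  (forall k, k <= size (g k)) ->
  let M := machine_of (Seq a (While x b)) in
  (forall k, emits M y p (g k)) /\
  (forall r, emits M y p r -> exists k, prefix r (g k)).
Proof.
move=> st Ha nz Hb Hg M.
have H k : exists2 t, k <= t & cout (run M y p t) = g k.
  suff /reach_run[t E] : reach y (entry (Seq a (While x b))) (start_state W p)
      (Some (inr None)) (st k).
    exists t; last by rewrite E.
    apply: leq_trans (Hg k) _.
    by have := run_out_size M y p t; rewrite E.
  elim: k => [|k IH]; first exact: (reach_inl (While x b) Ha).
  by apply: reach_cat IH _; exact: (reach_inr a (@reach_while _ y x b (st k) _ nz (Hb k))).
split=> [k|r [t pr]]; first by have [t _ E] := H k; exists t; rewrite E prefix_refl.
by exists t; apply: prefix_trans pr _; have [t' tt' <-] := H t; exact: run_out_prefix.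
Qed.

(** * Counter programs *)

Definition nreg := 23.
Definition reg (x : nat) : 'I_nreg := inord x.

Definition upd (f : nat -> nat) (x v : nat) : nat -> nat :=
  fun w => if w == x then v else f w.

Fixpoint addto (f : nat -> nat) (xs : seq nat) (v : nat) : nat -> nat :=
  if xs is x :: xs' then upd (addto f xs' v) x (f x + v) else f.

Lemma addtoE f xs v w : addto f xs v w = if w \in xs then f w + v else f w.
Proof.
elim: xs => //= x xs IH; rewrite /upd in_cons; case: eqP => [->|_] //=.
Qed.

(* Register 0 always holds the position of the auxiliary head. *)
Definition St (f : nat -> nat) (a : nat) (i o : seq bool) : state 'I_nreg :=
  State (fun w : 'I_nreg => if val w == 0 then a else f w) a i o.

Lemma St_ext f g a i o : (forall w, f w = g w) -> St f a i o = St g a i o.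
Proof. by move=> fg; rewrite (funext fg). Qed.

Lemma regs_St f a i o x : 0 < x < nreg -> regs (St f a i o) (reg x) = f x.
Proof.
case/andP=> x0 xn; rewrite /St /= -[(nat_of_ord (reg x) == 0)]/(_ == 0) /reg inordK //.
by case: x x0 xn.
Qed.

Ltac neqs := repeat match goal with
  | H : is_true (?a != ?b) |- context [?a == ?b] => rewrite (negPf H)
  | H : is_true (?a != ?b) |- context [?b == ?a] => rewrite (eq_sym b a) (negPf H)
  | |- context [?a == ?a] => rewrite eqxx
  end.

Section Programs.
Variable y : auxtape.

Lemma runs_eq (c : cmd 'I_nreg) s s1 s2 : runs y c s s1 -> s1 = s2 -> runs y c s s2.
Proof. by move=> H <-. Qed.

Lemma prim_exit (g : option bool -> option bool -> ('I_nreg -> bool) -> primact 'I_nreg)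
    (s : state 'I_nreg) mv ax out :
  g None (y (auxpos s)) (fun w => regs s w == 0) = PrimAct false mv ax out ->
  runs y (Prim false g) s
    (State (fun w => do_move (mv w) (regs s w)) (do_move ax (auxpos s)) (input s)
       (if out is Some o then rcons (output s) o else output s)).
Proof. by move=> E; apply: reach_step; rewrite /loc_step /= /do_trans /= E. Qed.

Lemma prim_again (g : option bool -> option bool -> ('I_nreg -> bool) -> primact 'I_nreg)
    (s s' : state 'I_nreg) mv ax out :
  g None (y (auxpos s)) (fun w => regs s w == 0) = PrimAct true mv ax out ->
  runs y (Prim false g)
    (State (fun w => do_move (mv w) (regs s w)) (do_move ax (auxpos s)) (input s)
       (if out is Some o then rcons (output s) o else output s)) s' ->
  runs y (Prim false g) s s'.
Proof. by move=> E; apply: reach_trans; rewrite /loc_step /= /do_trans /= E. Qed.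

Definition decinc (x : nat) (xs : seq nat) : 'I_nreg -> move :=
  fun w => if val w == x then MLeft else if val w \in xs then MRight else MStay.

Definition Dec (x : nat) (xs : seq nat) : cmd 'I_nreg :=
  Prim false (fun _ _ _ => PrimAct false (decinc x xs) MStay None).

Definition Inc (x : nat) : cmd 'I_nreg :=
  Prim false (fun _ _ _ => PrimAct false
    (fun w => if val w == x then MRight else MStay) MStay None).

Definition Move (x : nat) (xs : seq nat) : cmd 'I_nreg :=
  Prim false (fun _ _ z =>
    if z (reg x) then PrimAct false (fun=> MStay) MStay None
    else PrimAct true (decinc x xs) MStay None).

Lemma decinc_St (f : nat -> nat) a x (xs : seq nat) : 0 < x -> 0 \notin xs -> x \notin xs ->
  (fun w : 'I_nreg => do_move (decinc x xs w) (if val w == 0 then a else f w)) =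
  (fun w : 'I_nreg => if val w == 0 then a else upd (addto f xs 1) x (f x).-1 w).
Proof.
move=> x0 n0 nx; apply: funext => w; rewrite /decinc /upd addtoE -[nat_of_ord w]/(val w).
have [->|wx] := eqVneq (val w) x; first by rewrite eqn0Ngt x0.
have [->|w0] := eqVneq (val w) 0; first by rewrite (negPf n0).
by case: ifP => //= _; rewrite addn1.
Qed.

Lemma dec_spec f a i o x xs : 0 < x -> 0 \notin xs -> x \notin xs ->
  runs y (Dec x xs) (St f a i o) (St (upd (addto f xs 1) x (f x).-1) a i o).
Proof.
move=> x0 n0 nx; apply: runs_eq.
  by apply: prim_exit.
by rewrite /= decinc_St.
Qed.

Lemma inc_spec f a i o x : 0 < x ->
  runs y (Inc x) (St f a i o) (St (upd f x (f x).+1) a i o).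
Proof.
move=> x0; apply: runs_eq.
  by apply: prim_exit.
rewrite /St /=; congr State; apply: funext => w; rewrite /upd.
by have [->|//] := eqVneq (val w) x; case: (x) x0.
Qed.

Lemma move_spec f a i o x xs : 0 < x < nreg -> 0 \notin xs -> x \notin xs ->
  runs y (Move x xs) (St f a i o) (St (upd (addto f xs (f x)) x 0) a i o).
Proof.
move=> xr n0 nx; move Em: (f x) => m; elim: m f Em => [|m IH] f Em.
  apply: runs_eq; first by apply: prim_exit; rewrite regs_St // Em eqxx.
  apply: St_ext => w; rewrite /upd addtoE addn0 if_same.
  by case: eqP => // ->.
apply: prim_again; first by rewrite regs_St // Em.
rewrite /= decinc_St //; last by case/andP: xr.
apply: runs_eq; first by apply: IH; rewrite /upd eqxx Em.
apply: St_ext => w; rewrite /upd addtoE; case: eqP => // _.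
by rewrite !addtoE; case: (w \in xs) => //; rewrite -addnA add1n.
Qed.

Definition Clear x := Move x [::].

Definition AddTo x x' t := Seq (Move x [:: x'; t]) (Move t [:: x]).

Lemma addto_spec f a i o x x' t :
  0 < x < nreg -> 0 < x' -> 0 < t < nreg -> x != x' -> x != t -> x' != t ->
  f t = 0 ->
  runs y (AddTo x x' t) (St f a i o) (St (upd f x' (f x' + f x)) a i o).
Proof.
move=> xr xr' tr xx' xt x't ft.
have [x0 t0] : 0 < x /\ 0 < t by case/andP: xr; case/andP: tr.
apply: runs_seq.
  by apply: move_spec => //; rewrite !inE negb_or ?xx' // !(eq_sym 0) -!lt0n xr' t0.
apply: runs_eq.
  apply: move_spec => //; rewrite !inE; first by rewrite eq_sym -lt0n.
  by rewrite eq_sym.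
apply: St_ext => w; rewrite /= /upd; neqs; rewrite ft.
have [->|wt] := eqVneq w t; neqs => //.
by have [->|wx] := eqVneq w x; neqs.
Qed.

Definition MulInto x x' x2 t := While (reg x) (Seq (Dec x [::]) (AddTo x' x2 t)).

Lemma mul_spec f a i o x x' x2 t :
  0 < x < nreg -> 0 < x' < nreg -> 0 < x2 -> 0 < t < nreg ->
  [&& uniq [:: x; x'; x2; t] & f t == 0] ->
  runs y (MulInto x x' x2 t) (St f a i o)
    (St (upd (upd f x2 (f x2 + f x * f x')) x 0) a i o).
Proof.
move=> xr x'r x20 tr /andP[]; rewrite /= !inE !negb_or.
case/and4P=> /and3P[xx' xx2 xt] /andP[x'x2 x't] x2t _ /eqP ft.
have x0 : 0 < x by case/andP: xr.
move Em: (f x) => k; elim: k f ft Em => [|k IH] f ft Em.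
  apply: runs_eq; first by apply: runs_while0; rewrite regs_St.
  by apply: St_ext => w; rewrite /upd mul0n addn0; case: eqP => [->//|_]; case: eqP => [->|].
apply: runs_while; first by rewrite regs_St // Em.
  apply: runs_seq; first exact: dec_spec.
  by apply: addto_spec => //; rewrite /upd /= eq_sym (negPf xt).
apply: runs_eq.
  by apply: IH; rewrite /upd /=; neqs; rewrite ?Em.
apply: St_ext => w; rewrite /upd /=; neqs.
have [wx|wx] := eqVneq w x; rewrite ?wx; neqs => //.
by have [wx2|wx2] := eqVneq w x2; rewrite ?wx2; neqs; rewrite // -addnA -mulSn.
Qed.


Definition Double x x' t := Seq (AddTo x x' t) (Move x' [:: x]).

Lemma double_spec f a i o x x' t :
  0 < x < nreg -> 0 < x' < nreg -> 0 < t < nreg -> uniq [:: x; x'; t] ->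
  f t = 0 -> f x' = 0 ->
  runs y (Double x x' t) (St f a i o) (St (upd f x (f x).*2) a i o).
Proof.
move=> xr x'r tr; rewrite /= !inE !negb_or => /andP[/andP[xx' xt] /andP[x't _]] ft fx'.
have [x0 x'0] : 0 < x /\ 0 < x' by case/andP: xr; case/andP: x'r.
apply: runs_seq; first exact: addto_spec.
apply: runs_eq.
  by apply: move_spec => //; rewrite inE; neqs => //; rewrite eq_sym -lt0n.
apply: St_ext => w; rewrite /upd /=; neqs; rewrite fx' add0n addnn.
by rewrite /upd; have [wx'|wx'] := eqVneq w x'; rewrite ?wx'; neqs.
Qed.

(** The partner [x'] counts the finished rounds: the body can use it as an index, and the last
    [Move] restores [x] from it. *)
Definition Repeat x x' c := Seq (While (reg x) (Seq c (Dec x [:: x']))) (Move x' [:: x]).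

(** The state has two indices because data and loop counters advance at different moments: the body
    takes [k] to [k.+1], and the decrement closing the round then does the same to [l]. *)
Lemma repeat_spec (N : nat) (G : nat -> nat -> nat) (A : nat -> nat)
    (O : nat -> seq bool) x x' c i :
  0 < x < nreg -> 0 < x' < nreg -> x != x' ->
  let st k l := St (upd (upd (G k) x (N - l)) x' l) (A k) i (O k) in
  (forall k, k < N -> runs y c (st k k) (st k.+1 k)) ->
  runs y (Repeat x x' c) (st 0 0)
    (St (upd (upd (G N) x N) x' 0) (A N) i (O N)).
Proof.
move=> xr x'r xx' st H.
have [x0 x'0] : 0 < x /\ 0 < x' by case/andP: xr; case/andP: x'r.
apply: (@runs_seq _ _ _ _ _ (st N N)); last first.
  apply: runs_eq.
    by apply: move_spec => //; rewrite inE; neqs => //; rewrite eq_sym -lt0n.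
  apply: St_ext => w; rewrite /upd /=; neqs; rewrite subnn add0n.
  by rewrite /upd; have [//|wx'] := eqVneq w x'; case: (w == x).
suff W k : k <= N -> runs y (While (reg x) (Seq c (Dec x [:: x']))) (st (N - k) (N - k)) (st N N).
  by have := W N (leqnn N); rewrite subnn.
elim: k => [|k IH] kN.
  rewrite subn0; apply: runs_while0; rewrite regs_St // /upd; neqs; exact: subnn.
apply: runs_while; last by apply: IH; exact: ltnW.
  by rewrite regs_St // /upd; neqs; rewrite subKn.
have lt : N - k.+1 < N by rewrite ltn_subrL (leq_trans _ kN).
apply: runs_seq; first exact: H.
apply: runs_eq; first by apply: dec_spec => //; rewrite inE; neqs => //; rewrite eq_sym -lt0n.
rewrite /st -subSn // subSS; apply: St_ext => w; rewrite /upd /=; neqs.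
rewrite !subKn //; last exact: ltnW.
rewrite /upd addn1 -subSn // subSS; have [wx|wx] := eqVneq w x; rewrite ?wx; neqs => //.
by case: (w == x').
Qed.

Definition tape_has (a : nat) (s : seq bool) : Prop :=
  forall k, k < size s -> y (a + k) = Some (nth false s k).

Lemma tape_has_cat a s s' :
  tape_has a (s ++ s') <-> tape_has a s /\ tape_has (a + size s) s'.
Proof.
split=> [H|[H H'] k].
  split=> k ks; first by rewrite H ?size_cat ?ltn_addr // nth_cat ks.
  by rewrite -addnA H ?size_cat ?ltn_add2l // nth_cat ltnNge leq_addr /= addKn.
rewrite size_cat nth_cat; case: (ltnP k (size s)) => [ks _|ks]; first by rewrite H.
by rewrite -{1}(subnKC ks) ltn_add2l => /H'; rewrite -addnA subnKC.
Qed.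

Definition incs (xs : seq nat) : 'I_nreg -> move :=
  fun w => if (val w == 0) || (val w \in xs) then MRight else MStay.

Lemma incs_St (f : nat -> nat) a (xs : seq nat) : 0 \notin xs ->
  (fun w : 'I_nreg => do_move (incs xs w) (if val w == 0 then a else f w)) =
  (fun w : 'I_nreg => if val w == 0 then a.+1 else addto f xs 1 w).
Proof.
move=> n0; apply: funext => w; rewrite /incs addtoE -[nat_of_ord w]/(val w).
have [->|w0] //= := eqVneq (val w) 0.
by case: ifP => //= _; rewrite addn1.
Qed.

Definition AuxBit (xs : seq nat) : cmd 'I_nreg :=
  Prim false (fun _ s _ =>
    PrimAct false (incs (if s == Some true then xs else [::])) MRight None).

Definition AuxUnary (xs : seq nat) : cmd 'I_nreg :=
  Prim false (fun _ s _ =>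
    if s == Some true then PrimAct true (incs xs) MRight None
    else PrimAct false (incs [::]) MRight None).

Lemma auxbit_spec f a i o xs b : 0 \notin xs -> tape_has a [:: b] ->
  runs y (AuxBit xs) (St f a i o) (St (addto f xs b) a.+1 i o).
Proof.
move=> n0 /(_ 0 isT); rewrite addn0 /= => yb.
apply: runs_eq; first exact: prim_exit.
rewrite /= yb /St; congr State; rewrite incs_St; last by case: b {yb}.
apply: funext => w; case: ifP => // _; case: b {yb} => //=.
by rewrite addtoE addn0 if_same.
Qed.

Lemma auxunary_spec f a i o xs m : 0 \notin xs -> tape_has a (enc_nat m) ->
  runs y (AuxUnary xs) (St f a i o) (St (addto f xs m) (a + m.+1) i o).
Proof.
move=> n0; elim: m f a => [|m IH] f a H.
  have := H 0 isT; rewrite addn0 /= => ya.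
  apply: runs_eq; first by apply: prim_exit; rewrite /= ya.
  rewrite /= /St addn1; congr State; rewrite incs_St //.
  by apply: funext => w; case: ifP => //= _; rewrite addtoE addn0 if_same.
have := H 0 isT; rewrite addn0 /= => ya.
apply: prim_again; first by rewrite /= ya.
rewrite /= incs_St //; apply: runs_eq.
  by apply: IH; move: H; rewrite -[enc_nat m.+1]/([:: true] ++ enc_nat m) tape_has_cat addn1 => -[].
rewrite addSnnS; apply: St_ext => w; rewrite !addtoE.
by case: (w \in xs) => //; rewrite -addnA add1n.
Qed.

(** Nothing on the auxiliary tape marks its first cell; register 0, which mirrors the head position,
    tells when it is reached. *)
Definition Rewind : cmd 'I_nreg :=
  Prim false (fun _ _ z =>
    if z (reg 0) then PrimAct false (fun=> MStay) MStay None
    else PrimAct true (fun w => if val w == 0 then MLeft else MStay) MLeft None).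

Lemma rewind_spec f a i o : runs y Rewind (St f a i o) (St f 0 i o).
Proof.
elim: a => [|a IH].
  by apply: runs_eq; first by apply: prim_exit; rewrite /= inordK.
apply: prim_again; first by rewrite /= inordK.
rewrite [State _ _ _ _](_ : _ = St f a i o) //.
by rewrite /St /=; congr State; apply: funext => w; case: eqP.
Qed.

Definition ReadUnary (x : nat) : cmd 'I_nreg :=
  Prim true (fun b _ _ =>
    if b == Some true then
      PrimAct true (fun w => if val w == x then MRight else MStay) MStay None
    else PrimAct false (fun=> MStay) MStay None).

Lemma readunary_spec f a i o x m : 0 < x ->
  runs y (ReadUnary x) (St f a (enc_nat m ++ i) o) (St (upd f x (f x + m)) a i o).
Proof.
move=> x0; elim: m f => [|m IH] f.
  apply: reach_step; rewrite /loc_step /= /do_trans /=; congr (Some (_, _)).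
  by apply: St_ext => w; rewrite /upd addn0; case: eqP => // ->.
apply: reach_trans; first by rewrite /loc_step /= /do_trans /=.
rewrite [State _ _ _ _](_ : _ = St (upd f x (f x).+1) a (enc_nat m ++ i) o).
  apply: runs_eq; first exact: IH.
  by apply: St_ext => w; rewrite /upd eqxx addSnnS; case: eqP.
rewrite /St /=; congr State; apply: funext => w; rewrite /upd -[nat_of_ord w]/(val w).
by have [->|//] := eqVneq (val w) x; rewrite eqn0Ngt x0.
Qed.

Definition OutUnary (x : nat) : cmd 'I_nreg :=
  Prim false (fun _ _ z =>
    if z (reg x) then PrimAct false (fun=> MStay) MStay (Some false)
    else PrimAct true (decinc x [::]) MStay (Some true)).

Lemma outunary_spec f a i o x : 0 < x < nreg ->
  runs y (OutUnary x) (St f a i o) (St (upd f x 0) a i (o ++ enc_nat (f x))).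
Proof.
move=> xr; move Em: (f x) => m; elim: m f o Em => [|m IH] f o Em.
  apply: runs_eq; first by apply: prim_exit; rewrite regs_St // Em eqxx.
  rewrite /= -cats1; apply: St_ext => w; rewrite /upd.
  by case: eqP => // ->.
apply: prim_again; first by rewrite regs_St // Em.
rewrite /= decinc_St //; last by case/andP: xr.
apply: runs_eq; first by apply: IH; rewrite /upd eqxx Em.
by rewrite -cats1 -catA; apply: St_ext => w; rewrite /upd /=; case: eqP.
Qed.

Definition OutSign (x : nat) : cmd 'I_nreg :=
  Prim false (fun _ _ z => PrimAct false (fun=> MStay) MStay (Some (~~ z (reg x)))).

Lemma outsign_spec f a i o x : 0 < x < nreg ->
  runs y (OutSign x) (St f a i o) (St f a i (rcons o (f x != 0))).
Proof.
move=> xr; apply: runs_eq; first exact: prim_exit.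
by rewrite regs_St.
Qed.

End Programs.

Arguments upd f x v w /.

Lemma upd_id f x v : f x = v -> upd f x v = f.
Proof. by move=> <-; apply: funext => w /=; case: eqP => // ->. Qed.

Lemma flatten_take_nth (ss : seq (seq bool)) k : k < size ss ->
  size (flatten (take k.+1 ss)) = size (flatten (take k ss)) + size (nth [::] ss k).
Proof. by move=> ks; rewrite (take_nth [::] ks) flatten_rcons size_cat. Qed.

Lemma tape_has_nth y a (ss : seq (seq bool)) k :
  tape_has y a (flatten ss) -> k < size ss ->
  tape_has y (a + size (flatten (take k ss))) (nth [::] ss k).
Proof.
move=> + ks; rewrite -{1}(cat_take_drop k ss) (drop_nth [::] ks) flatten_cat /=.
by case/tape_has_cat=> _ /tape_has_cat[].
Qed.

Lemma tape_has_take y a (ss : seq (seq bool)) k :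
  tape_has y a (flatten ss) -> tape_has y a (flatten (take k ss)).
Proof. by rewrite -{1}(cat_take_drop k ss) flatten_cat => /tape_has_cat[]. Qed.

(* N is the number of qubits, L the number of rationals in a block, M the number of blocks
   to skip, I the index of the current rational and Rem what remains of the loop over I;
   L', M' and I' are partners of [Repeat].  (S, A, B) and (S2, A2, B2) are a sign, a
   numerator and a denominator; the running dot product is (P - Q) / D and Pw is 2^j.
   The other registers are scratch and vanish between two macros. *)
Local Notation rN := 1.
Local Notation rL := 2.
Local Notation rL' := 3.
Local Notation rM := 4.
Local Notation rM' := 5.
Local Notation rRem := 6.
Local Notation rI := 7.
Local Notation rI' := 8.
Local Notation rS := 9.
Local Notation rA := 10.
Local Notation rB := 11.
Local Notation rS2 := 12.
Local Notation rA2 := 13.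
Local Notation rB2 := 14.
Local Notation rP := 15.
Local Notation rQ := 16.
Local Notation rD := 17.
Local Notation rPw := 18.
Local Notation rt := 19.
Local Notation rT := 20.
Local Notation rT2 := 21.
Local Notation rC := 22.

Ltac regs := apply: St_ext => ?; rewrite /=;
  repeat (match goal with |- context [?w == ?x] => is_var w; 
    case: (w =P x) => [?|_]; [subst w|]; rewrite /= end).

(** * Reading rationals from the tape and accumulating the dot product *)

Section Navigation.
Variable y : auxtape.

Lemma skip_spec f a i o x x' c (ss : seq (seq bool)) :
  0 < x < nreg -> 0 < x' < nreg -> x != x' ->
  f x = size ss -> f x' = 0 -> tape_has y a (flatten ss) ->
  (forall k a', k < size ss -> tape_has y a' (nth [::] ss k) ->
     let g := upd (upd f x (size ss - k)) x' k in
     runs y c (St g a' i o) (St g (a' + size (nth [::] ss k)) i o)) ->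
  runs y (Repeat x x' c) (St f a i o) (St f (a + size (flatten ss)) i o).
Proof.
move=> xr x'r xx' fx fx' ya H.
have := @repeat_spec y (size ss) (fun=> f) (fun k => a + size (flatten (take k ss)))
  (fun=> o) x x' c i xr x'r xx'.
rewrite /= take0 addn0 take_size subn0 !(upd_id fx) !(upd_id fx'); apply=> k ks.
rewrite flatten_take_nth // addnA; apply: H => //.
exact: tape_has_nth.
Qed.

Definition RatScan (xs ys zs : seq nat) :=
  Seq (AuxBit xs) (Seq (AuxUnary ys) (AuxUnary zs)).

Definition sgn_of (q : rat) : nat := (numq q < 0)%R.
Definition num_of (q : rat) : nat := `|numq q|%N.
Definition den_of (q : rat) : nat := `|denq q|%N.

Lemma ratscan_spec f a i o xs ys zs q :
  0 \notin xs -> 0 \notin ys -> 0 \notin zs -> tape_has y a (enc_rat q) ->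
  runs y (RatScan xs ys zs) (St f a i o)
    (St (addto (addto (addto f xs (sgn_of q)) ys (num_of q)) zs (den_of q))
       (a + size (enc_rat q)) i o).
Proof.
move=> nx ny nz.
rewrite [enc_rat q](_ : _ = [:: (numq q < 0)%R] ++ enc_nat (num_of q) ++ enc_nat (den_of q)) //.
move=> /tape_has_cat[H1 /tape_has_cat[H2 H3]].
apply: runs_seq; first exact: (auxbit_spec _ _ _ nx H1).
rewrite addn1 in H2 H3.
apply: runs_seq; first exact: (auxunary_spec _ _ _ ny H2).
rewrite !size_rcons !size_nseq in H3.
apply: runs_eq; first exact: (auxunary_spec _ _ _ nz H3).
by rewrite !size_cat !size_rcons !size_nseq !addnA addn1.
Qed.

Definition SkipRats x x' := Repeat x x' (RatScan [::] [::] [::]).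

Definition enc_rats (qs : seq rat) := flatten [seq enc_rat q | q <- qs].

Lemma skiprats_spec f a i o x x' qs :
  0 < x < nreg -> 0 < x' < nreg -> x != x' ->
  f x = size qs -> f x' = 0 -> tape_has y a (enc_rats qs) ->
  runs y (SkipRats x x') (St f a i o) (St f (a + size (enc_rats qs)) i o).
Proof.
move=> xr x'r xx' fx fx' ya; apply: skip_spec => //; first by rewrite size_map.
move=> k a'; rewrite size_map => ks; rewrite (nth_map 0%R) // => H.
exact: (@ratscan_spec _ _ _ _ [::] [::] [::]).
Qed.

Definition block n qs := enc_nat n ++ enc_rats qs.

Definition Entry s a b :=
  Seq (AuxUnary [::]) (Seq (SkipRats rI rI') (Seq (RatScan [:: s] [:: a] [:: b]) Rewind)).

Lemma entry_spec f a0 i o s a b n qs :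
  0 < s -> 0 < a -> 0 < b -> tape_has y a0 (block n qs) ->
  f rI < size qs -> f rI' = 0 ->
  let q := nth 0%R qs (f rI) in
  runs y (Entry s a b) (St f a0 i o)
    (St (addto (addto (addto f [:: s] (sgn_of q)) [:: a] (num_of q)) [:: b] (den_of q))
       0 i o).
Proof.
move=> s0 a_0 b0 /tape_has_cat[H1 H2] iq i'0 q.
apply: runs_seq; first exact: (auxunary_spec _ _ _ _ H1).
rewrite size_rcons size_nseq in H2.
apply: runs_seq.
  apply: (@skiprats_spec _ _ _ _ _ _ (take (f rI) qs)) => //.
    by rewrite size_takel // ltnW.
  by rewrite /enc_rats map_take; exact: tape_has_take.
apply: runs_seq; last first.
  apply: (@rewind_spec _ _ (a0 + n.+1 + size (enc_rats (take (f rI) qs)) + size (enc_rat q))).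
rewrite -[addto f [::] n]/f; apply: ratscan_spec; rewrite ?inE ?(eq_sym 0) -?lt0n //.
rewrite /enc_rats map_take /q -(nth_map 0%R [::]) //.
by apply: tape_has_nth => //; rewrite size_map.
Qed.

Definition SkipBlocks := Repeat rM rM' (Seq (AuxUnary [::]) (SkipRats rL rL')).

Lemma skipblocks_spec f a i o n qss :
  f rM = size qss -> f rM' = 0 -> f rL' = 0 -> (forall qs, qs \in qss -> size qs = f rL) ->
  tape_has y a (flatten [seq block n qs | qs <- qss]) ->
  runs y SkipBlocks (St f a i o)
    (St f (a + size (flatten [seq block n qs | qs <- qss])) i o).
Proof.
move=> fM fM' fL' sz ya; apply: skip_spec => //; first by rewrite size_map.
move=> k a'; rewrite size_map => ks; rewrite (nth_map [::]) // => /tape_has_cat[H1 H2] g.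
apply: runs_seq; first exact: (auxunary_spec _ _ _ _ H1).
rewrite size_rcons size_nseq in H2.
apply: runs_eq.
  by apply: (@skiprats_spec _ _ _ _ _ _ (nth [::] qss k)) => //; rewrite /= sz ?mem_nth.
by rewrite /block size_cat size_rcons size_nseq addnA.
Qed.

(** Block 0 of the tape is [rho], so [E_k] stands behind [k.+1] blocks, the value that [rM] is
    given. *)
Definition Fetch s a b := Seq SkipBlocks (Entry s a b).

Lemma fetch_spec f i o s a b n qss :
  0 < s -> 0 < a -> 0 < b ->
  tape_has y 0 (flatten [seq block n qs | qs <- qss]) ->
  f rM < size qss -> f rM' = 0 -> f rL' = 0 -> f rI' = 0 -> f rI < f rL ->
  (forall qs, qs \in qss -> size qs = f rL) ->
  let q := nth 0%R (nth [::] qss (f rM)) (f rI) in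
  runs y (Fetch s a b) (St f 0 i o)
    (St (addto (addto (addto f [:: s] (sgn_of q)) [:: a] (num_of q)) [:: b] (den_of q))
       0 i o).
Proof.
move=> s0 a0 b0 ya fM fM' fL' fI' fI sz q.
apply: runs_seq.
  apply: (@skipblocks_spec _ _ _ _ n (take (f rM) qss)) => //.
  - by rewrite size_takel // ltnW.
  - by move=> qs /mem_take; exact: sz.
  - by rewrite map_take; exact: tape_has_take.
apply: (@entry_spec _ _ _ _ _ _ _ n) => //; last by rewrite sz // mem_nth.
rewrite map_take -(nth_map [::] [::]) //.
by apply: tape_has_nth => //; rewrite size_map.
Qed.

Definition SignMove : cmd 'I_nreg :=
  Prim false (fun _ _ z =>
    if z (reg rT2) then PrimAct false (fun=> MStay) MStay None
    else PrimAct true (decinc rT2 [:: if z (reg rS) == z (reg rS2) then rP else rQ])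
           MStay None).

Lemma signmove_spec f a i o :
  let x := if (f rS == 0) == (f rS2 == 0) then rP else rQ in
  runs y SignMove (St f a i o) (St (upd (upd f x (f x + f rT2)) rT2 0) a i o).
Proof.
move=> x; move Em: (f rT2) => m; elim: m f @x Em => [|m IH] f x Em.
  apply: runs_eq; first by apply: prim_exit; rewrite regs_St // Em eqxx.
  by rewrite addn0 (upd_id (erefl (f x))) (upd_id Em).
apply: prim_again; first by rewrite !regs_St // Em.
rewrite -/x /= decinc_St //; try by rewrite /x; case: ifP.
apply: runs_eq; first by apply: IH; rewrite /= Em.
have E v : v != rP -> v != rQ -> v != rT2 -> upd (addto f [:: x] 1) rT2 (f rT2).-1 v = f v.
  move=> v1 v2 v3; have /negPf xv : v != x by rewrite /x; case: ifP.
  by rewrite /= (negPf v3) xv.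
rewrite !(E rS) // !(E rS2) // -/x; apply: St_ext => w; rewrite /x; case: ifP => _ /=.
  by case: eqP => // _; case: eqP => // _; rewrite -addnA add1n.
by case: eqP => // _; case: eqP => // _; rewrite -addnA add1n.
Qed.

(** Addition of fractions without cancellation: with [c = B * B2], both [P] and [Q] are multiplied
    by [c], the new term contributes [A * A2 * D], and the common denominator becomes [D * c].
    Counters cannot be negative, so the signs decide between [P] and [Q]. *)
Definition Accum :=
  Seq (MulInto rA rA2 rT rt) (Seq (Clear rA2)
  (Seq (MulInto rB rB2 rC rt) (Seq (Clear rB2)
  (Seq (MulInto rT rD rT2 rt)
  (Seq (Move rP [:: rT]) (Seq (MulInto rT rC rP rt)
  (Seq (Move rQ [:: rT]) (Seq (MulInto rT rC rQ rt)
  (Seq (Move rD [:: rT]) (Seq (MulInto rT rC rD rt)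
  (Seq SignMove (Seq (Clear rS) (Seq (Clear rS2) (Clear rC)))))))))))))).

Lemma accum_spec f a i o :
  f rt = 0 -> f rT = 0 -> f rT2 = 0 -> f rC = 0 ->
  let t := f rA * f rA2 * f rD in
  let c := f rB * f rB2 in
  let same := (f rS == 0) == (f rS2 == 0) in
  runs y Accum (St f a i o)
    (St (upd (upd (upd (upd (upd (upd (upd (upd (upd f
       rS 0) rA 0) rB 0) rS2 0) rA2 0) rB2 0)
       rP (f rP * c + if same then t else 0)) rQ (f rQ * c + if same then 0 else t))
       rD (f rD * c)) a i o).
Proof.
move=> ft fT fT2 fC t c same.
pose G S A B S2 A2 B2 P Q D T T2 C := upd (upd (upd (upd (upd (upd (upd (upd (upd (upd (upd (upd f
  rS S) rA A) rB B) rS2 S2) rA2 A2) rB2 B2) rP P) rQ Q) rD D) rT T) rT2 T2) rC C.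
pose r S A B S2 A2 B2 P Q D T T2 C := St (G S A B S2 A2 B2 P Q D T T2 C) a i o.
have [fS fS2] := (erefl (f rS), erefl (f rS2)).
move: {2}(f rS) {2}(f rS2) fS fS2 => S S2 fS fS2.
rewrite [St f a i o](_ : _ = r S (f rA) (f rB) S2 (f rA2) (f rB2) (f rP) (f rQ) (f rD) 0 0 0);
  last by rewrite /r /G; regs.
set p := f rP; set q := f rQ; set d := f rD.
apply: (@runs_seq _ _ _ _ _ (r S 0 (f rB) S2 (f rA2) (f rB2) p q d (f rA * f rA2) 0 0)).
  by apply: runs_eq; [apply: mul_spec; rewrite /G //= ft | rewrite /r /G; regs; rewrite /c /t ?add0n].
apply: (@runs_seq _ _ _ _ _ (r S 0 (f rB) S2 0 (f rB2) p q d (f rA * f rA2) 0 0)).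
  by apply: runs_eq; [apply: move_spec | rewrite /r /G; regs].
apply: (@runs_seq _ _ _ _ _ (r S 0 0 S2 0 (f rB2) p q d (f rA * f rA2) 0 c)).
  by apply: runs_eq; [apply: mul_spec; rewrite /G //= ft | rewrite /r /G; regs; rewrite /c /t ?add0n].
apply: (@runs_seq _ _ _ _ _ (r S 0 0 S2 0 0 p q d (f rA * f rA2) 0 c)).
  by apply: runs_eq; [apply: move_spec | rewrite /r /G; regs].
apply: (@runs_seq _ _ _ _ _ (r S 0 0 S2 0 0 p q d 0 t c)).
  by apply: runs_eq; [apply: mul_spec; rewrite /G //= ft | rewrite /r /G; regs; rewrite /c /t ?add0n].
apply: (@runs_seq _ _ _ _ _ (r S 0 0 S2 0 0 0 q d p t c)).
  by apply: runs_eq; [apply: move_spec | rewrite /r /G; regs].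
apply: (@runs_seq _ _ _ _ _ (r S 0 0 S2 0 0 (p * c) q d 0 t c)).
  by apply: runs_eq; [apply: mul_spec; rewrite /G //= ft | rewrite /r /G; regs; rewrite /c /t ?add0n].
apply: (@runs_seq _ _ _ _ _ (r S 0 0 S2 0 0 (p * c) 0 d q t c)).
  by apply: runs_eq; [apply: move_spec | rewrite /r /G; regs].
apply: (@runs_seq _ _ _ _ _ (r S 0 0 S2 0 0 (p * c) (q * c) d 0 t c)).
  by apply: runs_eq; [apply: mul_spec; rewrite /G //= ft | rewrite /r /G; regs; rewrite /c /t ?add0n].
apply: (@runs_seq _ _ _ _ _ (r S 0 0 S2 0 0 (p * c) (q * c) 0 d t c)).
  by apply: runs_eq; [apply: move_spec | rewrite /r /G; regs].
apply: (@runs_seq _ _ _ _ _ (r S 0 0 S2 0 0 (p * c) (q * c) (d * c) 0 t c)).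
  by apply: runs_eq; [apply: mul_spec; rewrite /G //= ft | rewrite /r /G; regs; rewrite /c /t ?add0n].
apply: (@runs_seq _ _ _ _ _ (r S 0 0 S2 0 0 (p * c + if same then t else 0)
    (q * c + if same then 0 else t) (d * c) 0 0 c)).
  apply: runs_eq; first exact: signmove_spec.
  rewrite /r [X in if X then _ else _](_ : _ = same); last by rewrite /same fS fS2.
  by rewrite /G; case: same; regs; rewrite ?addn0.
apply: (@runs_seq _ _ _ _ _ (r 0 0 0 S2 0 0 (p * c + if same then t else 0)
    (q * c + if same then 0 else t) (d * c) 0 0 c)).
  by apply: runs_eq; [apply: move_spec | rewrite /r /G; regs].
apply: (@runs_seq _ _ _ _ _ (r 0 0 0 0 0 0 (p * c + if same then t else 0)
    (q * c + if same then 0 else t) (d * c) 0 0 c)).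
  by apply: runs_eq; [apply: move_spec | rewrite /r /G; regs].
by apply: runs_eq; [apply: move_spec | rewrite /G; regs].
Qed.

End Navigation.

(** * Reduced fractions *)

(* Scratch registers of the division: after counting up to c, u = c mod (Y + 1),
   v = Y - u and q = c / (Y + 1). *)
Local Notation ru := 12.
Local Notation rv := 13.
Local Notation rq := 14.
Local Notation rd := 16.
Local Notation rz := 21.
Local Notation rX := 22.

Section Reduction.
Variable y : auxtape.

Lemma runs_eq2 (c : cmd 'I_nreg) s s' s0 s1 :
  runs y c s s' -> s0 = s -> s' = s1 -> runs y c s0 s1.
Proof. by move=> H -> <-. Qed.

Lemma countdown_spec (G : nat -> nat -> nat) a i o x c N : 0 < x < nreg ->
  (forall k l, k + l < N -> runs y c (St (upd (G k) x l) a i o) (St (upd (G k.+1) x l) a i o)) ->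
  runs y (While (reg x) (Seq (Dec x [::]) c)) (St (upd (G 0) x N) a i o)
    (St (upd (G N) x 0) a i o).
Proof.
move=> xr; have x0 : 0 < x by case/andP: xr.
elim: N G => [|N IH] G H.
  by apply: runs_while0; rewrite regs_St //= eqxx.
apply: runs_while; first by rewrite regs_St //= eqxx.
  apply: runs_seq; first exact: dec_spec.
  rewrite [St (upd _ _ _) _ _ _](_ : _ = St (upd (G 0) x N) a i o); first by apply: H; rewrite add0n.
  by apply: St_ext => w /=; rewrite eqxx; case: eqP.
by apply: (IH (fun k => G k.+1)) => k l kl; apply: H; rewrite addSn ltnS.
Qed.

(** A single step cannot empty [ru], so the wrap-around is only flagged in [rz]; the inner loop of
    [Divide], entered at most once per tick, carries it out. *)
Definition DivTick : cmd 'I_nreg :=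
  Prim false (fun _ _ z => PrimAct false
    (if z (reg rv) then decinc rX [:: rz]
     else fun w => if (val w == rX) || (val w == rv) then MLeft
                   else if val w == ru then MRight else MStay) MStay None).

Lemma divtick_spec f a i o :
  runs y DivTick (St f a i o)
    (St (if f rv == 0 then upd (upd f rz (f rz).+1) rX (f rX).-1
         else upd (upd (upd f rX (f rX).-1) rv (f rv).-1) ru (f ru).+1) a i o).
Proof.
apply: runs_eq; first exact: prim_exit.
rewrite regs_St //; case: ifP => _ /=.
  by rewrite decinc_St // /St /= addn1.
rewrite /St; congr State; apply: funext => w /=; rewrite -[nat_of_ord w]/(val w).
have [->//|w22] := eqVneq (val w) 22; have [->//|w13] := eqVneq (val w) 13.
by have [->//|w12] := eqVneq (val w) 12.
Qed.

Definition Divide := While (reg rX) (Seq DivTick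
  (While (reg rz) (Seq (Dec rz [:: rq]) (Move ru [:: rv])))).

(** Any starting count [c] is allowed because the search passes from [x * d] to [x * d.+1] by
    counting on, without restarting the division. *)
Lemma divide_spec f a i o Y c k : f rz = 0 ->
  let g c := upd (upd (upd f ru (c %% Y.+1)) rv (Y - c %% Y.+1)) rq (c %/ Y.+1) in
  runs y Divide (St (upd (g c) rX k) a i o) (St (upd (g (c + k)) rX 0) a i o).
Proof.
move=> fz g; elim: k c => [|k IH] c.
  by rewrite addn0; apply: runs_while0; rewrite regs_St.
apply: runs_while; [by rewrite regs_St | | by rewrite -addSnnS; exact: IH].
apply: runs_seq; first exact: divtick_spec.
rewrite [upd (g c) rX _ rv](_ : _ = Y - c %% Y.+1) //.
have cY : c %% Y.+1 <= Y by rewrite -ltnS ltn_mod.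
case: ifPn => [|vn0]; last first.
  apply: runs_eq; first by apply: runs_while0; rewrite regs_St.
  have nd : (Y.+1 %| c.+1) = false.
    apply/negP => /eqP d0; have := modnS c Y.+1; rewrite /dvdn d0 eqxx /=.
    have: c.+1 %% Y.+1 = 0 by [].
    rewrite -addn1 -modnDml addn1 => + _.
    by rewrite modn_small ?ltnS // ltn_neqAle cY andbT; apply: contra vn0 => /eqP ->; rewrite subnn.
  rewrite /g modnS divnS // nd add0n.
  by regs; rewrite ?subnS.
rewrite subn_eq0 => Yc; have cE : c %% Y.+1 = Y by apply/eqP; rewrite eqn_leq cY.
have d : Y.+1 %| c.+1 by rewrite /dvdn -addn1 -modnDml cE addn1 modnn.
apply: runs_while; first by rewrite regs_St.
  apply: runs_seq; first exact: dec_spec.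
  exact: move_spec.
apply: runs_eq; first by apply: runs_while0; rewrite regs_St //= fz.
rewrite /g modnS divnS // d cE; by regs; rewrite ?fz ?subnn ?subn0 ?addn1.
Qed.

(* The reduced denominator of x / y is the least d > 0 such that y divides x * d. *)
Definition SearchStep := Seq (Inc rd) (Seq (AddTo rT rX rt) Divide).
Definition Search := Seq SearchStep (While (reg ru) SearchStep).

Lemma search_spec f a i o Y x e : f rz = 0 -> f rt = 0 -> f rT = x ->
  0 < e -> Y.+1 %| x * e -> (forall e', 0 < e' < e -> ~~ (Y.+1 %| x * e')) ->
  let h e := upd (upd (upd (upd (upd f ru (x * e %% Y.+1)) rv (Y - x * e %% Y.+1))
    rq (x * e %/ Y.+1)) rX 0) rd e in
  runs y Search (St (h 0) a i o) (St (h e) a i o).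
Proof.
move=> fz ft fT e0 de min h.
have step l : runs y SearchStep (St (h l) a i o) (St (h l.+1) a i o).
  apply: runs_seq; first exact: inc_spec.
  apply: runs_seq; first by apply: addto_spec.
  rewrite [St _ _ _ _](_ : _ = St (upd (upd (upd (upd (upd f rd l.+1)
     ru (x * l %% Y.+1)) rv (Y - x * l %% Y.+1)) rq (x * l %/ Y.+1)) rX x) a i o);
    last by rewrite /h; regs; rewrite ?fT.
  apply: runs_eq; first exact: divide_spec.
  by rewrite /h -mulnSr; regs.
(* Without this unconditional step the loop would stop at [d = 0], where the remainder is 0. *)
apply: runs_seq; first exact: step.
have W l : l < e -> runs y (While (reg ru) SearchStep) (St (h (e - l)) a i o) (St (h e) a i o).
  elim: l => [|l IH] le.
    by rewrite subn0; apply: runs_while0; rewrite regs_St //=; apply/eqP.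
  apply: runs_while; last by apply: IH; exact: ltnW.
    by rewrite regs_St //=; apply: min; rewrite subn_gt0 le ltn_subrL e0.
  rewrite -(subnSK (ltnW le)).
  exact: step.
by have := W e.-1; rewrite -{3}(prednK e0) subSnn prednK //; apply.
Qed.

End Reduction.

Lemma num_den_of (q : rat) : (`|q| = (num_of q)%:R / (den_of q)%:R)%R.
Proof.
by rewrite -[q in LHS]divq_num_den normrM normfV -!intr_norm -!abszE !pmulrn.
Qed.

Lemma den_of_gt0 (q : rat) : 0 < den_of q.
Proof. by rewrite absz_gt0 denq_neq0. Qed.

(** From [num_of q * Y = X * den_of q]: if [Y] divides [X * e], then [den_of q] divides
    [num_of q * e], hence [e] by coprimality. The search thus stops exactly at the fraction that
    [enc_rat] writes. *)
Lemma reduced_fraction (X Y : nat) (q : rat) : 0 < Y ->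
  (`|q| = X%:R / Y%:R)%R ->
  [/\ Y %| X * den_of q, (X * den_of q) %/ Y = num_of q &
      forall e, 0 < e < den_of q -> ~~ (Y %| X * e)].
Proof.
move=> Y0; rewrite num_den_of => E.
have {}E : num_of q * Y = X * den_of q.
  apply/eqP; rewrite -(eqr_nat rat) !natrM.
  move/eqP: E; rewrite eqr_div // pnatr_eq0 -lt0n //; exact: den_of_gt0.
split; first by rewrite -E dvdn_mull.
  by rewrite -E mulnK.
move=> e /andP[e0 ed]; apply/negP => /dvdnP[k kE].
have : den_of q %| num_of q * e.
  apply/dvdnP; exists k; apply/eqP; rewrite -(eqn_pmul2r Y0) mulnAC E.
  by rewrite mulnAC kE mulnAC.
rewrite Gauss_dvdr; last by rewrite coprime_sym; exact: coprime_num_den.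
by move/(dvdn_leq e0); rewrite leqNgt ed.
Qed.

Section Print.
Variable y : auxtape.

(** The unreduced numerator and denominator of the product go to [rT] and [rv]; [Dec rv] is there
    because division by [Y.+1] starts from [v = Y]. *)
Definition PrintEntry :=
  Seq (MulInto rA rD rT rt) (Seq (MulInto rB rP rv rt) (Seq (Dec rv [::])
  (Seq Search (Seq (OutSign rS) (Seq (OutUnary rq) (Seq (OutUnary rd)
  (Seq (Clear rT) (Seq (Clear rv) (Clear rS))))))))).

Lemma printentry_spec f a i o (x : rat) mn md :
  f ru = 0 -> f rv = 0 -> f rq = 0 -> f rd = 0 -> f rz = 0 -> f rX = 0 ->
  f rt = 0 -> f rT = 0 -> f rS = sgn_of x -> f rA = num_of x -> f rB = den_of x ->
  f rD = mn -> f rP = md -> 0 < mn -> 0 < md ->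
  runs y PrintEntry (St f a i o)
    (St (upd (upd (upd f rS 0) rA 0) rB 0) a i
       (o ++ enc_rat (x * (mn%:R / md%:R))%R)).
Proof.
move=> fu fv fq fd fz fX ft fT fS fA fB fD fP mn0 md0.
set c : rat := (mn%:R / md%:R)%R; have c0 : (0 < c)%R by rewrite divr_gt0 // ltr0n.
have Y0 : 0 < den_of x * md by rewrite muln_gt0 den_of_gt0.
have [||d1 d2 d3] := @reduced_fraction (num_of x * mn) (den_of x * md) (x * c)%R.
- by [].
- by rewrite normrM (gtr0_norm c0) num_den_of !natrM /c mulf_div.
set e := den_of (x * c)%R in d1 d2 d3.
move EY: (den_of x * md).-1 => Y; have {}EY : den_of x * md = Y.+1 by rewrite -EY prednK.
rewrite EY in d1 d2 d3.
set X := num_of x * mn in d1 d2 d3.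
pose G A B S T u v q d := upd (upd (upd (upd (upd (upd (upd (upd f rA A) rB B) rS S) rT T)
  ru u) rv v) rq q) rd d.
pose r A B S T u v q d := St (G A B S T u v q d) a i.
apply: (@runs_seq _ _ _ _ _ (r 0 (den_of x) (sgn_of x) X 0 0 0 0 o)).
  by apply: runs_eq; [apply: mul_spec; rewrite //= ft | rewrite /r /G; regs; rewrite ?fT ?fA ?fD].
apply: (@runs_seq _ _ _ _ _ (r 0 0 (sgn_of x) X 0 Y.+1 0 0 o)).
  by apply: runs_eq; [apply: mul_spec; rewrite /G //= ft | rewrite /r /G; regs; rewrite ?fP ?EY].
apply: (@runs_seq _ _ _ _ _ (r 0 0 (sgn_of x) X 0 Y 0 0 o)).
  by apply: runs_eq; [apply: dec_spec | rewrite /r /G; regs].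
apply: (@runs_seq _ _ _ _ _ (r 0 0 (sgn_of x) X 0 Y (num_of (x * c)%R) e o)).
  have e0 : 0 < e by exact: den_of_gt0.
  have := @search_spec y (G 0 0 (sgn_of x) X 0 0 0 0) a i o Y X e fz ft (erefl _) e0 d1 d3.
  rewrite /= muln0 mod0n div0n subn0 d2 (eqP d1) subn0 => H.
  by apply: (runs_eq2 H); rewrite /r /G; regs.
apply: (@runs_seq _ _ _ _ _ (r 0 0 (sgn_of x) X 0 Y (num_of (x * c)%R) e (rcons o (sgn_of x != 0)))).
  exact: outsign_spec.
apply: (@runs_seq _ _ _ _ _ (r 0 0 (sgn_of x) X 0 Y 0 e
    (rcons o (sgn_of x != 0) ++ enc_nat (num_of (x * c)%R)))).
  by apply: runs_eq; [apply: outunary_spec | rewrite /r /G; regs].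
apply: (@runs_seq _ _ _ _ _ (r 0 0 (sgn_of x) X 0 Y 0 0
    (o ++ enc_rat (x * c)%R))).
  apply: runs_eq; [apply: outunary_spec => // | rewrite /r /G].
  rewrite [_ ++ _](_ : _ = o ++ enc_rat (x * c)%R); first by regs.
  rewrite /enc_rat /enc_int -cats1 -!catA /= /sgn_of; congr (_ ++ _ :: _).
  (* The scaling factor is positive, so the product has the sign of [x]. *)
  by rewrite !numq_lt0 pmulr_llt0 //; case: (x < 0)%R.
apply: (@runs_seq _ _ _ _ _ (r 0 0 (sgn_of x) 0 0 Y 0 0 (o ++ enc_rat (x * c)%R))).
  by apply: runs_eq; [apply: move_spec | rewrite /r /G; regs].
apply: (@runs_seq _ _ _ _ _ (r 0 0 (sgn_of x) 0 0 0 0 0 (o ++ enc_rat (x * c)%R))).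
  by apply: runs_eq; [apply: move_spec | rewrite /r /G; regs].
by apply: runs_eq; [apply: move_spec | rewrite /r /G; regs].
Qed.

End Print.

(** * The machine printing a rescaled POVM element *)

Definition acc_step (x : nat * nat * nat) (r e : rat) : nat * nat * nat :=
  let t := num_of e * num_of r * x.2 in
  let c := den_of e * den_of r in
  let same := (sgn_of e == 0) == (sgn_of r == 0) in
  (x.1.1 * c + (if same then t else 0), x.1.2 * c + (if same then 0 else t), x.2 * c).

Fixpoint acc (r e : seq rat) (k : nat) : nat * nat * nat :=
  if k is k'.+1 then acc_step (acc r e k') (nth 0%R r k') (nth 0%R e k')
  else (0, 0, 1).

Lemma sgn_num_den (q : rat) : (q = (-1) ^+ sgn_of q * ((num_of q)%:R / (den_of q)%:R))%R.
Proof.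
rewrite -num_den_of /sgn_of numq_lt0.
by have [q0|q0] := ltP q 0%R; rewrite ?expr1 ?expr0 ?mul1r ?mulN1r ?(ltr0_norm q0) ?opprK ?ger0_norm.
Qed.

Lemma acc_sum (r e : seq rat) (k : nat) :
  0 < (acc r e k).2 /\
  (((acc r e k).1.1%:R - (acc r e k).1.2%:R) / (acc r e k).2%:R =
   \sum_(l < k) nth 0 r l * nth 0 e l :> rat)%R.
Proof.
elim: k => [|k [IH0 IH]]; first by rewrite big_ord0 subrr mul0r.
rewrite big_ord_recr /= -IH; case: (acc r e k) IH0 => [[P Q] D] /= D0 {IH}.
set p := nth 0%R r k; set q := nth 0%R e k.
have [p0 q0] := (den_of_gt0 p, den_of_gt0 q).
split; first by rewrite !muln_gt0 D0 q0 p0.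
have D0' : (D%:R != 0 :> rat)%R by rewrite pnatr_eq0 -lt0n.
have p0' : ((den_of p)%:R != 0 :> rat)%R by rewrite pnatr_eq0 -lt0n.
have q0' : ((den_of q)%:R != 0 :> rat)%R by rewrite pnatr_eq0 -lt0n.
rewrite [X in (_ = _ + X * _)%R]sgn_num_den [X in (_ = _ + _ * X)%R]sgn_num_den.
rewrite /sgn_of; case: (numq q < 0)%R; case: (numq p < 0)%R;
  rewrite /= ?expr0 ?expr1 !natrD !natrM; field; rewrite ?D0' ?p0' ?q0' //.
Qed.

(** A branch coded as a loop run at most once: when [P] is 0 it becomes 1, and the flag in [rT2]
    makes the next loop of the prologue replace [D] by [2 ^ j]. *)
Definition ZeroFix : cmd 'I_nreg :=
  Prim false (fun _ _ z => PrimAct false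
    (fun w => if z (reg rP) && ((val w == rT2) || (val w == rP)) then MRight else MStay)
    MStay None).

Section Main.
Variable y : auxtape.

Lemma zerofix_spec f a i o :
  runs y ZeroFix (St f a i o)
    (St (if f rP == 0 then upd (upd f rT2 (f rT2).+1) rP 1 else f) a i o).
Proof.
apply: runs_eq; first exact: prim_exit.
rewrite regs_St //; case: eqP => [P0|_] //=.
rewrite /St; congr State; apply: funext => w /=; rewrite -[nat_of_ord w]/(val w).
have [->/=|w15] := eqVneq (val w) 15; first by rewrite P0.
by have [->|w21] := eqVneq (val w) 21.
Qed.

(** A block consists of [2 ^ n * 2 ^ n] entries of two rationals each; its length [2 * 4 ^ n] is
    reached from 2 by quadrupling [n] times. *)
Definition Quadruple := Seq (Double rL rT2 rt) (Double rL rT2 rt).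

Definition AccumEntry := Seq (Entry rS2 rA2 rB2) (Seq (Fetch rS rA rB) Accum).

(* On the program [enc_nat k ++ enc_nat j], leaves in D / P the factor by which E_k is to be
   multiplied: the inverse of the dot product, or 2^j if the latter is 0. *)
Definition Prologue :=
  Seq (ReadUnary rM) (Seq (Inc rM) (Seq (ReadUnary rS2) (Seq (AuxUnary [:: rN]) (Seq Rewind
  (Seq (Inc rL) (Seq (Inc rL) (Seq (AddTo rN rT rt)
  (Seq (While (reg rT) (Seq (Dec rT [::]) Quadruple))
  (Seq (Inc rPw) (Seq (While (reg rS2) (Seq (Dec rS2 [::]) (Double rPw rT2 rt)))
  (Seq (Inc rD) (Seq (AddTo rL rRem rt) (Seq (Repeat rRem rI AccumEntry)
  (Seq (While (reg rQ) (Seq (Dec rQ [::]) (Dec rP [::])))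
  (Seq ZeroFix (While (reg rT2) (Seq (Dec rT2 [::]) (Seq (Clear rD) (Move rPw [:: rD]))))))))))))))))))).

Definition PrintMatrix :=
  Seq (AddTo rN rT rt) (Seq (OutUnary rT) (Repeat rRem rI (Seq (Fetch rS rA rB) PrintEntry))).

Definition base n L m rem ix P Q D pw : nat -> nat :=
  upd (upd (upd (upd (upd (upd (upd (upd (upd (fun=> 0)
    rN n) rL L) rM m) rRem rem) rI ix) rP P) rQ Q) rD D) rPw pw.

Definition bst n L m rem ix P Q D pw i o : state 'I_nreg :=
  St (base n L m rem ix P Q D pw) 0 i o.

Variables (n k j : nat) (qss : seq (seq rat)).
Hypothesis y_qss : tape_has y 0 (flatten [seq block n qs | qs <- qss]).
Hypothesis size_qss : size qss = k.+2.
Let L := 2 * 4 ^ n.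
Hypothesis size_qs : forall qs, qs \in qss -> size qs = L.
Let r := nth [::] qss 0.
Let e := nth [::] qss k.+1.

Let size_r : size r = L. Proof. by apply: size_qs; rewrite mem_nth ?size_qss. Qed.
Let size_e : size e = L. Proof. by apply: size_qs; rewrite mem_nth ?size_qss. Qed.

Lemma accum_loop pw i o :
  runs y (Repeat rRem rI AccumEntry) (bst n L k.+1 L 0 0 0 1 pw i o)
    (bst n L k.+1 L 0 (acc r e L).1.1 (acc r e L).1.2 (acc r e L).2 pw i o).
Proof.
pose G l := base n L k.+1 0 0 (acc r e l).1.1 (acc r e l).1.2 (acc r e l).2 pw.
have H := @repeat_spec y L G (fun=> 0) (fun=> o) rRem rI AccumEntry i isT isT isT.
apply: (runs_eq2 (H _)) => [l lL||]; rewrite ?subn0; try by rewrite /bst /G /base; regs.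
have yr : tape_has y 0 (block n r).
  have := @tape_has_nth _ _ _ 0 y_qss; rewrite take0 addn0 size_map size_qss (nth_map [::]) ?size_qss //.
  exact.
apply: runs_seq.
  by apply: (@entry_spec _ _ _ _ _ _ _ _ n r) => //=; rewrite size_r.
apply: runs_seq.
  by apply: (@fetch_spec _ _ _ _ _ _ _ n qss) => //=; rewrite size_qss.
apply: runs_eq; first exact: accum_spec.
rewrite /G /base /=; case: (acc r e l) => [[P Q] D] /=.
by regs; rewrite ?add0n.
Qed.

(** The test is [0 < D], not [D != 0], because the counters give the truncated difference [P - Q],
    which vanishes whenever the sum is not positive. For traces of products of positive matrices the
    two tests agree. *)
Definition scale : rat :=
  let D := (\sum_(l < L) nth 0 r l * nth 0 e l)%R in
  if (0 < D)%R then D^-1%R else (2 ^ j)%:R%R.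

Let N := (acc r e L).1.1 - (acc r e L).1.2.
Let md := if N == 0 then 1 else N.
Let mn := if N == 0 then 2 ^ j else (acc r e L).2.
Let pw := if N == 0 then 0 else 2 ^ j.

Let md0 : 0 < md. Proof. by rewrite /md; case: eqP => // /eqP; rewrite -lt0n. Qed.
Let mn0 : 0 < mn.
Proof. by rewrite /mn; case: eqP => // _; [rewrite expn_gt0 | case: (acc_sum r e L)]. Qed.

Lemma scaleE : scale = (mn%:R / md%:R)%R.
Proof.
rewrite /scale; have [D0 <-] := acc_sum r e L.
rewrite /mn /md /N; case: (acc r e L) D0 => [[P Q] D] /= D0.
rewrite pmulr_lgt0 ?invr_gt0 ?ltr0n // subr_gt0 ltr_nat subn_eq0.
by case: ltnP => [PQ|PQ]; rewrite ?divr1 // invf_div natrB // ltnW.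
Qed.

Lemma prologue_spec i o :
  runs y Prologue (St (fun=> 0) 0 (enc_nat k ++ enc_nat j ++ i) o)
    (bst n L k.+1 L 0 md 0 mn pw i o).
Proof.
set i1 := enc_nat j ++ i.
apply: (@runs_seq _ _ _ _ _ (bst 0 0 k 0 0 0 0 0 0 i1 o)).
  by apply: runs_eq; [apply: readunary_spec | rewrite /bst /base; regs].
apply: (@runs_seq _ _ _ _ _ (bst 0 0 k.+1 0 0 0 0 0 0 i1 o)).
  by apply: runs_eq; [apply: inc_spec | rewrite /bst /base; regs].
pose jst n L rem pw j := St (upd (base n L k.+1 rem 0 0 0 0 pw) rS2 j) 0 i o.
apply: (@runs_seq _ _ _ _ _ (jst 0 0 0 0 j)).
  by apply: runs_eq; [apply: readunary_spec | rewrite /jst /base; regs].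
apply: (@runs_seq _ _ _ _ _ (St (upd (base n 0 k.+1 0 0 0 0 0 0) rS2 j) n.+1 i o)).
  apply: runs_eq; first apply: (@auxunary_spec _ _ _ _ _ _ n) => //.
    have := @tape_has_nth _ _ _ 0 y_qss; rewrite take0 addn0 size_map size_qss => /(_ isT).
    by rewrite (nth_map [::]) ?size_qss // => /tape_has_cat[].
  by rewrite /base; regs.
apply: (@runs_seq _ _ _ _ _ (jst n 0 0 0 j)); first exact: rewind_spec.
apply: (@runs_seq _ _ _ _ _ (jst n 1 0 0 j)).
  by apply: runs_eq; [apply: inc_spec | rewrite /jst /base; regs].
apply: (@runs_seq _ _ _ _ _ (jst n 2 0 0 j)).
  by apply: runs_eq; [apply: inc_spec | rewrite /jst /base; regs].
apply: (@runs_seq _ _ _ _ _ (St (upd (upd (base n 2 k.+1 0 0 0 0 0 0) rS2 j) rT n) 0 i o)).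
  by apply: runs_eq; [apply: addto_spec | rewrite /jst /base; regs].
apply: (@runs_seq _ _ _ _ _ (jst n L 0 0 j)).
  have H := @countdown_spec y (fun l => upd (base n (2 * 4 ^ l) k.+1 0 0 0 0 0 0) rS2 j)
    0 i o rT Quadruple n isT.
  apply: (runs_eq2 (H _)) => [l l' _||]; rewrite /jst /base; try by regs.
  apply: runs_seq; first exact: double_spec.
  apply: runs_eq; first exact: double_spec.
  by rewrite expnS; regs; rewrite -?mul2n ?mulnA.
apply: (@runs_seq _ _ _ _ _ (jst n L 0 1 j)).
  by apply: runs_eq; [apply: inc_spec | rewrite /jst /base; regs].
apply: (@runs_seq _ _ _ _ _ (bst n L k.+1 0 0 0 0 0 (2 ^ j) i o)).
  have H := @countdown_spec y (fun l => base n L k.+1 0 0 0 0 0 (2 ^ l))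
    0 i o rS2 (Double rPw rT2 rt) j isT.
  apply: (runs_eq2 (H _)) => [l l' _||]; rewrite /jst /bst /base; try by regs.
  apply: runs_eq; first exact: double_spec.
  by rewrite expnS; regs; rewrite -?mul2n.
apply: (@runs_seq _ _ _ _ _ (bst n L k.+1 0 0 0 0 1 (2 ^ j) i o)).
  by apply: runs_eq; [apply: inc_spec | rewrite /bst /base; regs].
apply: (@runs_seq _ _ _ _ _ (bst n L k.+1 L 0 0 0 1 (2 ^ j) i o)).
  by apply: runs_eq; [apply: addto_spec | rewrite /bst /base; regs].
apply: runs_seq; first exact: accum_loop.
rewrite /mn /md /pw /N; case: (acc r e L) => [[P Q] D] /=.
(* Counting [Q] down also clears its register, which serves as [rd] while printing. *)
apply: (@runs_seq _ _ _ _ _ (bst n L k.+1 L 0 (P - Q) 0 D (2 ^ j) i o)).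
  have H := @countdown_spec y (fun l => base n L k.+1 L 0 (P - l) 0 D (2 ^ j))
    0 i o rQ (Dec rP [::]) Q isT.
  apply: (runs_eq2 (H _)) => [l l' _||]; rewrite /bst /base ?subn0; try by regs.
  apply: runs_eq; first exact: dec_spec.
  by regs; rewrite ?subnS.
apply: runs_seq; first exact: zerofix_spec.
rewrite [base _ _ _ _ _ _ _ _ _ rP]/(P - Q); case: (P - Q =P 0) => [E|_] /=; last first.
  by apply: runs_while0; rewrite regs_St.
apply: runs_while; first by rewrite regs_St.
  apply: runs_seq; first exact: dec_spec.
  apply: runs_seq; first exact: move_spec.
  exact: move_spec.
apply: runs_eq; first by apply: runs_while0; rewrite regs_St.
by rewrite /bst /base; regs.
Qed.

Lemma printmatrix_spec i o :
  runs y PrintMatrix (bst n L k.+1 L 0 md 0 mn pw i o)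
    (bst n L k.+1 L 0 md 0 mn pw i (o ++ block n [seq (x * scale)%R | x <- e])).
Proof.
apply: (@runs_seq _ _ _ _ _ (St (upd (base n L k.+1 L 0 md 0 mn pw) rT n) 0 i o)).
  by apply: runs_eq; [apply: addto_spec | rewrite /base; regs].
apply: (@runs_seq _ _ _ _ _ (bst n L k.+1 L 0 md 0 mn pw i (o ++ enc_nat n))).
  by apply: runs_eq; [apply: outunary_spec | rewrite /bst /base; regs].
pose G (l : nat) := base n L k.+1 0 0 md 0 mn pw.
pose O l := o ++ enc_nat n ++ enc_rats (take l [seq (x * scale)%R | x <- e]).
have H := @repeat_spec y L G (fun=> 0) O rRem rI (Seq (Fetch rS rA rB) PrintEntry) i isT isT isT.
apply: (runs_eq2 (H _)) => [l lL||]; rewrite ?subn0; last first.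
- by rewrite /O take_oversize ?size_map ?size_e // /bst /G /base; regs.
- by rewrite /O take0 cats0 /bst /G /base; regs.
apply: runs_seq.
  by apply: (@fetch_spec _ _ _ _ _ _ _ n qss) => //=; rewrite size_qss.
rewrite [nth [::] qss _](_ : _ = e) // [upd _ _ _ rI](_ : _ = l) //; set q := nth 0%R e l.
apply: runs_eq; first exact: (@printentry_spec _ _ _ _ _ q mn md).
rewrite {2}/O (take_nth 0%R) ?size_map ?size_e // (nth_map 0%R) ?size_e // -/q.
rewrite /enc_rats map_rcons flatten_rcons -!catA -/(enc_rats _) -scaleE.
by rewrite /G /base; regs.
Qed.

(** [rD] holds the numerator of the factor, which is positive and preserved by [PrintMatrix]: the
    loop never ends and writes a constant infinite sequence. *)
Definition scaled_povm := machine_of (Seq Prologue (While (reg rD) PrintMatrix)).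

Lemma scaled_povm_emits :
  let g t := flatten (nseq t (block n [seq (x * scale)%R | x <- e])) in
  let p := enc_nat k ++ enc_nat j in
  (forall t, emits scaled_povm y p (g t)) /\
  (forall s, emits scaled_povm y p s -> exists t, prefix s (g t)).
Proof.
move=> g p.
have H := @emits_loop _ Prologue PrintMatrix (reg rD) y p (bst n L k.+1 L 0 md 0 mn pw [::] [::]) g.
apply: H.
- apply: (runs_eq2 (prologue_spec [::] [::])) => //.
  by rewrite /start_state /St cats0; congr State; apply: funext => w; rewrite if_same.
- by rewrite regs_St //= -lt0n.
- move=> t; apply: (runs_eq2 (printmatrix_spec _ (g t))) => //.
  rewrite /bst /St /=; congr State.
  by rewrite /g -{1}addn1 nseqD flatten_cat /= cats0.
- move=> t; elim: t => // t IH; rewrite /g /= size_cat -add1n; apply: leq_add IH.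
  by rewrite /block size_cat size_rcons.
Qed.

End Main.

(** * Simulation on a shifted auxiliary tape *)

Section Relay.
Variables (U : machine) (w : seq bool).

(* Writes w, skips [enc_nat n] on the auxiliary tape, simulates U on the rest of that tape,
   and where U halts copies program bits up to the first [false]. *)
Definition relay : machine :=
  @Machine (option ('I_(size w).+1 + mstate U)) (option (mwork U)) (option (msym U))
    (Some (mblank U)) (Some (inl ord0)) (pred1 None)
    (fun q => if q is Some (inr q) then mhalt q || reading q else false)
    (fun q p s g =>
       match q with
       | Some (inl i) =>
           if i < size w then
             Action (Some (inl (inord i.+1))) (fun k => (g k, MStay)) MStay
               (Some (nth false w i))
           else if s == Some true then
             Action (Some (inl i)) (fun k => (g k, MStay)) MRight None
           else Action (Some (inr (mstart U)))
                  (fun k => (if k is None then None else g k, MStay)) MRight None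
       | Some (inr q) =>
           if mhalt q then
             Action (if p == Some true then Some (inr q) else None)
               (fun k => (g k, MStay)) MStay p
           else
             let a := mtrans q p s [ffun v => odflt (mblank U) (g (Some v))] in
             let d := if g None is None then
                        (if act_aux a is MLeft then MStay else act_aux a)
                      else act_aux a in
             Action (Some (inr (act_state a)))
               (fun k => if k is Some v then (Some (act_work a v).1, (act_work a v).2)
                         else (g None, d)) d (act_out a)
       | None => Action None (fun k => (g k, MStay)) MStay None
       end).

Variables (n : nat) (y : auxtape).
Let z := cond_tape n y.
Let m := size (enc_nat n).

Lemma cond_tapeE a : z (m + a) = y a.
Proof. by rewrite /z /cond_tape -/m ltnNge leq_addr /= addKn. Qed.

(* The extra work tape, marked at cell 0, keeps the position of the simulated auxiliary head. *)
Definition lift_conf (c : config U) (rest : seq bool) : config relay :=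
  @Config relay (Some (inr (cstate c))) (cprog c ++ rest) (m + caux c)
    (fun k i => if k is Some v then Some (cwork c v i)
                else if i == 0 then None else Some (mblank U))
    (fun k => if k is Some v then cpos c v else caux c)
    (w ++ cout c).

(** At simulated position 0 a left move has to stay put, while the real head would slip back into
    [enc_nat n]. The mark on the extra tape, whose head moves in step with the auxiliary one, turns
    this move into [MStay]. *)
Lemma exec_lift (c : config U) b s rest : ~~ mhalt (cstate c) ->
  exec z (lift_conf c rest) b (s ++ rest) = lift_conf (exec y c b s) rest.
Proof.
move=> /negPf nh; pose g : {ffun mwork relay -> msym relay} :=
  [ffun k => cwork (lift_conf c rest) k (cpos (lift_conf c rest) k)].
rewrite /exec -/g /= nh cond_tapeE.
have gN : g None = (if caux c == 0 then None else Some (mblank U)) by rewrite ffunE.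
have -> : [ffun v => odflt (mblank U) (g (Some v))] = [ffun v => cwork c v (cpos c v)].
  by apply/ffunP => v; rewrite !ffunE.
set a := mtrans _ _ _ _; set d := if g None is None then _ else _.
have dE : do_move d (caux c) = do_move (act_aux a) (caux c) /\
    do_move d (m + caux c) = m + do_move (act_aux a) (caux c).
  rewrite /d gN; case: (caux c) => [|x] /=; case: (act_aux a); rewrite /= ?addn0 ?addnS //.
  by rewrite addn0.
rewrite /lift_conf /=; congr Config; first by case: dE.
- apply: funext => -[v|]; apply: funext => i; rewrite //= ?gN.
  + by case: eqP.
  + by case: eqP => // ->.
- by apply: funext => -[v|] //=; case: dE.
- by case: (act_out a) => //= bit; rewrite rcons_cat.
Qed.

(** Out of program bits, [U] blocks whereas the relay would read on into [rest]; the second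
    hypothesis excludes this. *)
Lemma step_lift (c : config U) rest : ~~ mhalt (cstate c) ->
  (reading (cstate c) -> cprog c != [::]) ->
  step z (lift_conf c rest) = lift_conf (step y c) rest.
Proof.
move=> nh; rewrite /step /= (negPf nh) /=; case: ifP => _.
  by case: (cprog c) => [|b s] // => [/(_ isT)|_] //=; exact: exec_lift.
by move=> _; exact: exec_lift.
Qed.

(** A halted [U] is a fixed point of [step], but the relay goes on to copy; so [t'] counts only the
    steps before [U] halts. *)
Lemma iter_lift t (c : config U) rest :
  mhalt (cstate (iter t (step y) c)) ->
  exists t', iter t' (step z) (lift_conf c rest) = lift_conf (iter t (step y) c) rest.
Proof.
elim: t c => [|t IH] c; first by exists 0.
rewrite iterSr; have [h _|nh] := boolP (mhalt (cstate c)).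
  have -> : step y c = c by rewrite /step h.
  have -> : iter t (step y) c = c by elim: t {IH} => //= t ->; rewrite /step h.
  by exists 0.
(* A blocked [U] stays blocked, so it would never halt. *)
have [blk|] := boolP (reading (cstate c) && (cprog c == [::])).
  case/andP: blk => rc /eqP pc.
  have sc : step y c = c by rewrite /step (negPf nh) rc pc.
  have -> : iter t (step y) (step y c) = c by rewrite sc; elim: t {IH} => //= t ->.
  by rewrite (negPf nh).
rewrite negb_and => ok /IH[t' E]; exists t'.+1; rewrite iterSr step_lift //.
by move=> rc; move: ok; rewrite rc.
Qed.

Let start_work (k : mwork relay) (i : nat) : msym relay := Some (mblank U).

Let pre (i : 'I_(size w).+1) a (out : seq bool) p : config relay :=
  @Config relay (Some (inl i)) p a start_work (fun=> 0) out.

Let work_id (f : mwork relay -> nat -> msym relay) :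
  (fun k i => if i == 0 then [ffun k => f k 0] k else f k i) = f.
Proof. by apply: funext => k; apply: funext => i; case: eqP => // ->; rewrite ffunE. Qed.

Lemma relay_start p :
  exists t, run relay z p t = lift_conf (init U [::]) p.
Proof.
have W i : i <= size w -> run relay z p i = pre (inord i) 0 (take i w) p.
  elim: i => [_|i IH iw].
    rewrite take0 /run /= /init /pre; congr Config; congr (Some (inl _)).
    by apply: val_inj; rewrite /= inordK.
  rewrite /run iterS -/(run _ _ _ i) IH ?(ltnW iw) // /step /= /exec /= inordK ?ltnS ?(ltnW iw) //.
  by rewrite iw /= work_id (take_nth false iw).
have S i : i <= n -> run relay z p (i + size w) = pre (inord (size w)) i w p.
  elim: i => [_|i IH iw]; first by rewrite W // take_size.
  rewrite addSn /run iterS -/(run _ _ _ _) IH ?(ltnW iw) // /step /= /exec /= inordK // ltnn.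
  have -> : z i = Some true.
    rewrite /z /cond_tape size_rcons size_nseq (ltn_trans iw) // onthE.
    rewrite (nth_map false) ?size_rcons ?size_nseq ?(ltn_trans iw) //.
    by rewrite nth_rcons size_nseq iw nth_nseq iw.
  by rewrite /= work_id.
exists (n + size w).+1; rewrite /run iterS -/(run _ _ _ _) S // /step /= /exec /= inordK // ltnn.
have -> : z n = Some false.
  rewrite /z /cond_tape size_rcons size_nseq ltnSn onthE.
  by rewrite (nth_map false) ?size_rcons ?size_nseq // nth_rcons size_nseq ltnn eqxx.
rewrite /lift_conf /= cats0 /m size_rcons size_nseq addn0; congr Config.
  by apply: funext => -[v|]; apply: funext => i; rewrite ?ffunE; case: eqP.
by apply: funext => -[].
Qed.

(** Halting states of [U] are reading states of the relay. The final [false] of [enc_nat j] is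
    itself copied and ends the copying. *)
Lemma relay_copy (c : config U) j : mhalt (cstate c) -> cprog c = [::] ->
  exists t, let d := iter t (step z) (lift_conf c (enc_nat j)) in
    [/\ mhalt (cstate d), cprog d = [::] & cout d = w ++ cout c ++ enc_nat j].
Proof.
move=> h pc; pose f i s := @Config relay (Some (inr (cstate c))) (enc_nat i) (m + caux c)
  (cwork (lift_conf c [::])) (cpos (lift_conf c [::])) s.
have E : lift_conf c (enc_nat j) = f j (w ++ cout c) by rewrite /lift_conf /f pc.
have S i s : exists t, let d := iter t (step z) (f i s) in
    [/\ mhalt (cstate d), cprog d = [::] & cout d = s ++ enc_nat i].
  elim: i s => [|i IH] s.
    by exists 1; rewrite /= /step /= h /= /exec /= h /= cats1.
  have [t [H1 H2 H3]] := IH (rcons s true); exists t.+1.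
  have E1 : step z (f i.+1 s) = f i (rcons s true).
    rewrite /step /= h /= /exec /= h /= /f; congr Config.
    by apply: funext => -[v|]; apply: funext => l; rewrite ffunE; case: eqP => // ->.
  by move=> d; rewrite /d iterSr E1; split=> //; rewrite H3 cat_rcons.
have [t [H1 H2 H3]] := S j (w ++ cout c).
by exists t; rewrite E; split=> //; rewrite H3 catA.
Qed.

Lemma relay_computes p x j : computes U y p x ->
  computes relay z (p ++ enc_nat j) (w ++ x ++ enc_nat j).
Proof.
move=> [t [h pc ox]].
have [t0 E0] := relay_start (p ++ enc_nat j).
have [t1 E1] := @iter_lift t (init U p) (enc_nat j) h.
have [t2 [H1 H2 H3]] := @relay_copy (run U y p t) j h pc.
exists (t2 + (t1 + t0)); rewrite /run iterD iterD -/(run _ _ _ t0) E0.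
(* The two are the same configuration: it does not show which part of the program is meant for
   [U]. *)
rewrite [lift_conf (init U [::]) _](_ : _ = lift_conf (init U p) (enc_nat j)) // E1.
by split=> //; rewrite H3 -/(run U y p t) ox.
Qed.

End Relay.

(** * Sums and traces *)

Section Sums.
Local Open Scope classical_set_scope.
Local Open Scope ring_scope.
Local Open Scope ereal_scope.
Variable R : realType.

Lemma subset_esum (T : choiceType) (I J : set T) (a : T -> \bar R) :
  I `<=` J -> (forall j, J j -> 0 <= a j) ->
  \esum_(i in I) a i <= \esum_(j in J) a j.
Proof.
move=> IJ a0; rewrite esum_mkcond [leRHS]esum_mkcond; apply: le_esum => i _.
have [/set_mem /IJ Ji|_] := boolP (i \in I); first by rewrite (mem_set Ji).
by case: ifPn => // /set_mem; exact: a0.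
Qed.

Lemma inj_esum_le (T T' : choiceType) (I : set T) (J : set T') (e : T -> T')
    (a : T' -> \bar R) :
  set_inj I e -> (forall i, I i -> J (e i)) -> (forall j, J j -> 0 <= a j) ->
  \esum_(i in I) a (e i) <= \esum_(j in J) a j.
Proof.
move=> einj IJ a0; rewrite -esum_image //; apply: subset_esum => //.
by move=> _ [i Ii <-]; exact: IJ.
Qed.

Lemma esumMr_le (T : choiceType) (I : set T) (a : T -> \bar R) (r : R) :
  (0 <= r)%R -> (forall i, 0 <= a i) ->
  \esum_(i in I) (a i * r%:E) <= (\esum_(i in I) a i) * r%:E.
Proof.
move=> r0 a0; apply: ge_ereal_sup => /= _ [X [finX XI]] <-.
rewrite -ge0_mule_fsuml //.
apply: lee_wpmul2r; first by rewrite lee_fin.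
by apply: esum_ge; exists X.
Qed.

Lemma esumMr (T : choiceType) (I : set T) (a : T -> \bar R) (r : R) :
  (0 < r)%R -> (forall i, 0 <= a i) ->
  \esum_(i in I) (a i * r%:E) = (\esum_(i in I) a i) * r%:E.
Proof.
move=> r0 a0; apply/eqP; rewrite eq_le; apply/andP; split.
  by apply: esumMr_le => //; exact: ltW.
rewrite -lee_pdivlMr //.
have := @esumMr_le T I (fun i => a i * r%:E) r^-1%R; rewrite invr_ge0 (ltW r0) => /(_ isT).
under eq_esum do rewrite -muleA -EFinM divff ?gt_eqF // mule1.
by apply=> i; rewrite mule_ge0 // lee_fin ltW.
Qed.

Lemma esum_cst_infty (c : \bar R) : 0 < c -> \esum_(i in [set: nat]) c = +oo.
Proof.
move=> c0; apply/eqyP => A A0.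
case: c c0 => [r||//] r0; last first.
  apply: esum_ge; exists [set 0%N]; last by rewrite fsbig_set1 leey.
  by split => //; exact: finite_set1.
have [N AN] : exists N : nat, (A <= r *+ N)%R.
  rewrite lte_fin in r0; exists (Num.bound (A / r)).
  rewrite -mulr_natl -ler_pdivrMr //; apply: ltW.
  by apply: archi_boundP; rewrite divr_ge0 ?ltW.
apply: esum_ge; exists `I_N; first by split => //; exact: finite_II.
by rewrite -fsbig_ord sumEFin lee_fin sumr_const card_ord.
Qed.

End Sums.

Section Traces.
Local Open Scope ring_scope.
Variable R : realType.

Lemma psd_row N (A : 'M[R[i]]_N) (P : 'M[R[i]]_N) j : psd A ->
  0 <= (P *m A *m map_mx Num.conj P^T) j j.
Proof.
move=> [_ /(_ (map_mx Num.conj (row j P)^T))].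
rewrite map_trmx trmxK -map_mx_comp (map_mx_id (@conjCK _)) => H.
congr (0 <= _): H.
rewrite -row_mul !mxE; apply: eq_bigr => l _; rewrite !mxE; congr (_ * _).
Qed.

(** Diagonalising [B] by a unitary [P] turns the trace into the sum of the eigenvalues of [B] times
    the diagonal entries of [P A P^*], all of them non-negative. *)
Lemma trace_psd_ge0 N (A B : 'M[R[i]]_N) : psd A -> psd B -> 0 <= \tr (A *m B).
Proof.
move=> pA pB; have [hB _] := pB.
have /hermitian_normalmx /orthomx_spectralP : B \is hermsymmx.
  by apply/is_hermitianmxP; rewrite expr0 scale1r hB.
set P := spectralmx B; set D := spectral_diag B => BE.
have uP : P \is unitarymx by exact: spectral_unitarymx.
have PV : invmx P = map_mx Num.conj P^T by rewrite invmx_unitary.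
have Punit : P \in unitmx by exact: spectral_unit.
have DE : diag_mx D = P *m B *m map_mx Num.conj P^T.
  by rewrite BE -PV !mulmxA mulmxV // mul1mx mulmxK.
have D0 j : 0 <= D 0 j.
  by have := @psd_row _ B P j pB; rewrite -DE mxE eqxx.
rewrite {1}BE PV !mulmxA mxtrace_mulC !mulmxA /mxtrace.
apply: sumr_ge0 => j _; rewrite mul_mx_diag mxE mulr_ge0 //.
exact: psd_row.
Qed.

End Traces.

(** * Matrices as lists of rationals *)

Section Entries.
Local Open Scope ring_scope.

Definition unpair (T : Type) (f : T -> rat * rat) (s : seq T) : seq rat :=
  flatten [seq [:: (f p).1; (f p).2] | p <- s].

Lemma size_unpair (T : Type) (f : T -> rat * rat) s :
  size (unpair f s) = (2 * size s)%N.
Proof. by elim: s => //= p s; rewrite /unpair /= => ->; rewrite mulnS. Qed.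

Lemma dot_unpair (T : Type) (f g : T -> rat * rat) s :
  \sum_(l < 2 * size s) (unpair f s)`_l * (unpair g s)`_l =
  \sum_(p <- s) ((f p).1 * (g p).1 + (f p).2 * (g p).2).
Proof.
elim: s => [|p s IH]; first by rewrite big_ord0 big_nil.
by rewrite /= mulnS !big_ord_recl big_cons /= -IH addrA.
Qed.

Definition indices n : seq ('I_(2 ^ n) * 'I_(2 ^ n)) :=
  [seq (i, j) | i <- enum 'I_(2 ^ n), j <- enum 'I_(2 ^ n)].

Definition entries n (A : emx n) : seq rat :=
  unpair (fun p => (A.1 p.1 p.2, A.2 p.1 p.2)) (indices n).

Lemma size_indices n : size (indices n) = (4 ^ n)%N.
Proof. by rewrite size_allpairs -!cardE card_ord -expnMn. Qed.

Lemma size_entries n (A : emx n) : size (entries A) = (2 * 4 ^ n)%N.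
Proof. by rewrite size_unpair size_indices. Qed.

Lemma enc_emxE n (A : emx n) : enc_emx A = block n (entries A).
Proof.
rewrite /enc_emx /block /enc_rats /entries; congr (_ ++ _).
rewrite [X in flatten X = _](_ : _ =
  [seq enc_rat (A.1 p.1 p.2) ++ enc_rat (A.2 p.1 p.2) | p <- indices n]).
  by elim: (indices n) => // p s IH; rewrite [LHS]/= IH -catA.
by rewrite map_allpairs.
Qed.

Definition emx_scale n (c : rat) (A : emx n) : emx n :=
  (map_mx (fun x => x * c) A.1, map_mx (fun x => x * c) A.2).

Lemma entries_scale n c (A : emx n) :
  entries (emx_scale c A) = [seq x * c | x <- entries A].
Proof.
by rewrite /entries; elim: (indices n) => //= p s; rewrite /unpair /= => ->; rewrite !mxE.
Qed.

End Entries.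

Section ElementaryMatrices.
Local Open Scope ring_scope.
Variable R : realType.

Lemma emx_val_scale n c (A : emx n) :
  emx_val R (emx_scale c A) = (ratr c)%:C%C *: emx_val R A.
Proof.
apply/matrixP => i j; rewrite !mxE /= !rmorphM /=.
by simpc; rewrite ![_ * ratr c]mulrC.
Qed.

Lemma psd_scale N (r : R) (A : 'M[R[i]]_N) : 0 <= r -> psd A -> psd (r%:C%C *: A).
Proof.
move=> r0 [hA pA]; split=> [|v].
  have -> : (r%:C%C *: A)^T = r%:C%C *: A^T by apply/matrixP => i j; rewrite !mxE.
  rewrite map_mxZ hA; congr (_ *: _); exact: conjc_real.
rewrite -scalemxAr -scalemxAl mxE mulr_ge0 //.
by rewrite ler0c.
Qed.

Lemma Re_sum (I : Type) (s : seq I) (F : I -> R[i]) :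
  complex.Re (\sum_(i <- s) F i) = \sum_(i <- s) complex.Re (F i).
Proof. by apply: (big_morph (@complex.Re R)) => // -[a b] [c d]. Qed.

Lemma Re_trace N (A B : 'M[R[i]]_N) :
  complex.Re (\tr (A *m B)) =
  \sum_i \sum_j (complex.Re (A i j) * complex.Re (B j i)
                 - complex.Im (A i j) * complex.Im (B j i)).
Proof.
rewrite /mxtrace Re_sum; apply: eq_bigr => i _.
rewrite mxE Re_sum; apply: eq_bigr => j _.
by case: (A i j) => a b; case: (B j i).
Qed.

(** Replacing [rho_ji] by the conjugate of [rho_ij] cancels the minus sign in the real part of a
    product: [Re (A_ij rho_ji) = Re A_ij Re rho_ij + Im A_ij Im rho_ij]. *)
Lemma trace_entries n (rho A : emx n) : psd (emx_val R rho) ->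
  complex.Re (\tr (emx_val R A *m emx_val R rho)) =
  ratr (\sum_(l < 2 * 4 ^ n) (entries rho)`_l * (entries A)`_l).
Proof.
move=> [/matrixP h _]; rewrite Re_trace -(size_indices n) dot_unpair.
rewrite big_allpairs rmorph_sum -big_enum /=; apply: eq_bigr => i _.
rewrite rmorph_sum -big_enum /=; apply: eq_bigr => j _.
have := h j i; rewrite !mxE => -[<- <-] /=.
by rewrite !rmorphD /= !rmorphM /= mulrN opprK ![_ * ratr (A.1 _ _)]mulrC ![_ * ratr (A.2 _ _)]mulrC.
Qed.

Lemma trace_real N (A B : 'M[R[i]]_N) : psd A -> psd B ->
  0 <= complex.Re (\tr (A *m B)) /\ \tr (A *m B) = (complex.Re (\tr (A *m B)))%:C%C.
Proof.
move=> pA pB; have := trace_psd_ge0 pA pB.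
by case: (\tr _) => a b; rewrite lecE /= => /andP[/eqP ->].
Qed.

End ElementaryMatrices.

Section Limits.
Local Open Scope classical_set_scope.
Local Open Scope ring_scope.
Import numFieldNormedType.Exports.
Variable R : realType.

Lemma cvg_sumr (I : Type) (s : seq I) (f : I -> nat -> R) (l : I -> R) :
  (forall i, f i @ \oo --> l i) ->
  (fun t => \sum_(i <- s) f i t) @ \oo --> \sum_(i <- s) l i.
Proof.
move=> fl; elim: s => [|i s IH].
  under eq_fun do rewrite big_nil.
  by rewrite big_nil; exact: cvg_cst.
under eq_fun do rewrite big_cons.
by rewrite big_cons; apply: cvgD.
Qed.

(** Meant for arbitrary tests: dropping those not built from [E] only decreases the universal sum
    because their traces with [sigma] are non-negative too. *)
Lemma trace_limit_ge0 N (A : nat -> 'M[R[i]]_N) (B C : 'M[R[i]]_N) :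
  (forall t, psd (A t)) -> mx_cvg A B -> psd C ->
  0 <= complex.Re (\tr (B *m C)).
Proof.
move=> pA AB pC.
have cv : (fun t => complex.Re (\tr (A t *m C))) @ \oo --> complex.Re (\tr (B *m C)).
  under eq_fun do rewrite Re_trace.
  rewrite Re_trace; apply: cvg_sumr => i; apply: cvg_sumr => j.
  have [AR AI] := AB i j.
  by apply: cvgB; apply: cvgMr_tmp.
rewrite -(cvg_lim _ cv) //; apply: limr_ge.
  by apply/cvg_ex; eexists; exact: cv.
by apply: nearW => t; case: (trace_real (pA t) pC).
Qed.

End Limits.

(** * Contents of the auxiliary tape *)

Section Tape.
Local Open Scope nat_scope.
Variables (n : nat) (rho : emx n) (K : option nat) (E : nat -> emx n).

Lemma in_len_le a b : a <= b -> in_len K b -> in_len K a.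
Proof. by case: K => //= K' ab; exact: leq_ltn_trans. Qed.

Lemma enc_first_split a b : a <= b -> exists s, enc_first K E b = enc_first K E a ++ s.
Proof.
move=> ab; exists (flatten [seq enc_emx (E j) | j <- iota a (b - a) & in_len K j]).
by rewrite /enc_first -{1}(subnKC ab) iotaD filter_cat map_cat flatten_cat.
Qed.

Lemma enc_firstE a : in_len K a ->
  enc_first K E a.+1 = flatten [seq enc_emx (E j) | j <- iota 0 a.+1].
Proof.
move=> Ka; rewrite /enc_first; congr (flatten (map _ _)); apply/all_filterP/allP => j.
by rewrite mem_iota add0n ltnS => /andP[_ /in_len_le]; apply.
Qed.

Lemma size_enc_first a : in_len K a -> a < size (enc_first K E a.+1).
Proof.
move=> Ka; rewrite enc_firstE // -[X in X <= _](size_iota 0 a.+1).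
elim: (iota _ _) => //= j s IH; rewrite size_cat -add1n; apply: leq_add IH.
by rewrite size_cat size_rcons.
Qed.

(** Cell [i] is defined through the first [i.+1] elements of [E], the claim through the first
    [k.+1]. The shorter of the two strings is a prefix of the longer and already reaches cell [i],
    in one case because blocks are nonempty. *)
Lemma rel_tape_has k : in_len K k ->
  tape_has (rel_tape rho K E) 0
    (flatten [seq block n qs | qs <- entries rho :: [seq entries (E j) | j <- iota 0 k.+1]]).
Proof.
move=> Kk.
have -> : flatten [seq block n qs | qs <- entries rho :: [seq entries (E j) | j <- iota 0 k.+1]] =
    enc_emx rho ++ enc_first K E k.+1.
  rewrite enc_firstE // enc_emxE map_cons -map_comp.
  by rewrite (@eq_map _ _ _ (fun j => enc_emx (E j))) // => j; rewrite /= enc_emxE.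
move=> i ilt; rewrite /rel_tape add0n.
have onthS (s : seq bool) : i < size s -> onth s i = Some (nth false s i).
  by move=> si; rewrite onthE (nth_map false).
have [ki|ik] := leqP k i.
  have [s ->] := @enc_first_split k.+1 i.+1 ki.
  rewrite catA; set s1 := enc_emx rho ++ _ in ilt *.
  have si : i < size (s1 ++ s) by rewrite size_cat; exact: ltn_addr.
  by rewrite onthS // nth_cat ilt.
have [s Es] := @enc_first_split i.+1 k.+1 (ltnW ik).
have isz : i < size (enc_emx rho ++ enc_first K E i.+1).
  by rewrite size_cat ltn_addl // size_enc_first // (in_len_le (ltnW ik)).
by rewrite onthS // Es catA [in RHS]nth_cat isz.
Qed.

End Tape.

Section Logarithm.
Local Open Scope ring_scope.
Local Open Scope ereal_scope.
Variable R : realType.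

(** The extended values are included: [log2e 0] is [-oo], and an infinite [x] forces an infinite
    [z]. *)
Lemma log2e_le (x z : \bar R) (m : nat) : 0 <= x ->
  x * ((2^-1 : R) ^+ m)%:E <= z -> log2e x <= log2e z + m%:R%:E.
Proof.
have l2 : (0 < ln (2 : R))%R by rewrite ln_gt0 // ltr1n.
have p0 : (0 < (2^-1 : R) ^+ m)%R by rewrite exprn_gt0 // invr_gt0.
case: x => [r||//] x0; last first.
  rewrite gt0_mulye ?lte_fin // leye_eq => /eqP ->.
  by rewrite /log2e /= gt0_mulye ?lte_fin ?invr_gt0 // leey.
rewrite lee_fin in x0; have [r0|r0] := leP r 0%R.
  by rewrite /log2e /= r0 gt0_mulNye ?lte_fin ?invr_gt0 // leNye.
case: z => [s||]; last by rewrite -EFinM leeNy_eq.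
  rewrite -EFinM lee_fin => rs; have s0 : (0 < s)%R by apply: lt_le_trans rs; rewrite mulr_gt0.
  rewrite /log2e !lne_EFin // -!EFinM -EFinD lee_fin -ler_pdivlMr ?invr_gt0 // invrK.
  rewrite mulrDl mulfVK ?gt_eqF // -lerBlDr.
  have -> : (ln r - m%:R * ln 2 = ln (r * 2^-1 ^+ m) :> R)%R.
    by rewrite lnM ?posrE // lnXn ?invr_gt0 // lnV ?posrE // mulNrn mulr_natl.
  by rewrite ler_ln ?posrE // mulr_gt0.
by move=> _; rewrite /log2e /= gt0_mulye ?lte_fin ?invr_gt0 // leey.
Qed.

End Logarithm.

(** * Comparison of the deficiencies *)

Section Deficiency.
Local Open Scope classical_set_scope.
Local Open Scope ring_scope.
Import numFieldNormedType.Exports.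
Variables (R : realType) (U : machine).

Lemma univ_prob_ge0 z x : (0 <= univ_prob R U z x)%E.
Proof. by apply: esum_ge0 => p _; rewrite lee_fin exprn_ge0 // invr_ge0. Qed.

Definition pair_scale n (rho A : emx n) (j : nat) : rat :=
  let D := \sum_(l < 2 * 4 ^ n) (entries rho)`_l * (entries A)`_l in
  if 0 < D then D^-1 else (2 ^ j)%:R.

Lemma pair_scale_gt0 n (rho A : emx n) j : 0 < pair_scale rho A j.
Proof.
rewrite /pair_scale; case: ifP => [D0|_]; first by rewrite invr_gt0.
by rewrite ltr0n expn_gt0.
Qed.

Lemma enc_first_cst n (A : emx n) t :
  enc_first None (fun=> A) t = flatten (nseq t (enc_emx A)).
Proof.
rewrite /enc_first filter_predT; congr flatten.
by elim: t 0%N => //= t IH a; rewrite IH.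
Qed.

(** With constant approximations, monotonicity and convergence are immediate; what matters is that
    [U] writes exactly this sequence. *)
Lemma lower_computes_scale n (rho : emx n) K E k j w1 :
  (forall z p,
    (forall x, computes U z (w1 ++ p) x <-> computes scaled_povm z p x) /\
    (forall s, emits U z (w1 ++ p) s <-> emits scaled_povm z p s)) ->
  in_len K k -> psd (emx_val R (E k)) ->
  lower_computes U (rel_tape rho K E) (w1 ++ enc_nat k ++ enc_nat j)
    (emx_val R (emx_scale (pair_scale rho (E k) j) (E k))).
Proof.
move=> w1P Kk pE; set c := pair_scale _ _ _; exists (fun=> emx_scale c (E k)).
have c0 : 0 <= (ratr c : R) by rewrite ler0q ltW // pair_scale_gt0.
split.
- by move=> t; rewrite emx_val_scale; exact: psd_scale.
- move=> t; rewrite /loewner_le subrr; split.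
    by apply/matrixP => a b; rewrite !mxE rmorph0.
  by move=> v; rewrite mulmx0 mul0mx mxE.
- by move=> a b; split; exact: cvg_cst.
have [_ eqU] := w1P (rel_tape rho K E) (enc_nat k ++ enc_nat j).
pose qss := entries rho :: [seq entries (E l) | l <- iota 0 k.+1].
have szq qs : qs \in qss -> size qs = (2 * 4 ^ n)%N.
  rewrite inE => /orP[/eqP ->|/mapP[l _ ->]]; exact: size_entries.
have szqq : size qss = k.+2 by rewrite /= size_map size_iota.
have := @scaled_povm_emits (rel_tape rho K E) n k j qss (rel_tape_has Kk) szqq szq.
have Ek : nth [::] qss k.+1 = entries (E k).
  by rewrite /qss -[nth _ _ _]/(nth [::] [seq entries (E l) | l <- iota 0 k.+1] k)
    (nth_map 0%N) ?size_iota // nth_iota.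
rewrite /scale Ek -[nth [::] qss 0]/(entries rho) -/(pair_scale rho (E k) j) -/c.
rewrite -entries_scale -enc_emxE /= => -[H1 H2]; split=> [t|s /eqU /H2[t ?]].
  by apply/eqU; rewrite enc_first_cst; exact: H1.
by exists t; rewrite enc_first_cst.
Qed.

(** The injection [p -> w2 ++ p ++ enc_nat j] takes programs of [k] on [y] to programs of the longer
    string on the tape with [n] in front, at the cost of [size w2 + j.+1] bits. *)
Lemma univ_prob_relay w1 w2 n y k j :
  (forall z p,
    (forall x, computes U z (w2 ++ p) x <-> computes (relay U w1) z p x) /\
    (forall s, emits U z (w2 ++ p) s <-> emits (relay U w1) z p s)) ->
  (univ_prob R U y (enc_nat k) * ((2^-1 : R) ^+ (size w2 + j.+1))%:E <=
   univ_prob R U (cond_tape n y) (w1 ++ enc_nat k ++ enc_nat j))%E.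
Proof.
move=> w2P; rewrite /univ_prob -esumMr; last 2 first.
- by rewrite exprn_gt0 // invr_gt0.
- by move=> p; rewrite lee_fin exprn_ge0 // invr_ge0.
under eq_esum => p _.
  rewrite -EFinM -exprD.
  have -> : (size p + (size w2 + j.+1) = size (w2 ++ p ++ enc_nat j))%N.
    by rewrite !size_cat size_rcons size_nseq addnCA.
  over.
apply: (@inj_esum_le _ _ _ _ _ (fun p => w2 ++ p ++ enc_nat j)
  (fun p => ((2^-1 : R) ^+ size p)%:E)).
- move=> p q _ _ /eqP; rewrite eqseq_cat // eqxx /= => /eqP E.
  have sz : size p = size q.
    by move/(congr1 size): E; rewrite !size_cat => /eqP; rewrite eqn_add2r => /eqP.
  by move/eqP: E; rewrite eqseq_cat // => /andP[/eqP].
- move=> p /= /(relay_computes w1 n j) H.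
  by have [/(_ (w1 ++ enc_nat k ++ enc_nat j)) [_ +] _] := w2P (cond_tape n y) (p ++ enc_nat j); apply.
- by move=> p _; rewrite lee_fin exprn_ge0 // invr_ge0.
Qed.

Section Bound.
Variables (w1 w2 : seq bool).
Hypothesis w1P : forall z p,
  (forall x, computes U z (w1 ++ p) x <-> computes scaled_povm z p x) /\
  (forall s, emits U z (w1 ++ p) s <-> emits scaled_povm z p s).
Hypothesis w2P : forall z p,
  (forall x, computes U z (w2 ++ p) x <-> computes (relay U w1) z p x) /\
  (forall s, emits U z (w2 ++ p) s <-> emits (relay U w1) z p s).
Variables (n : nat) (rho : emx n) (K : option nat) (E : nat -> emx n).
Variable sigma : 'M[R[i]]_(2 ^ n).
Hypothesis psd_rho : psd (emx_val R rho).
Hypothesis psd_sigma : psd sigma.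
Hypothesis psd_E : forall k, in_len K k -> psd (emx_val R (E k)).
Let y := rel_tape rho K E.
Let gam k := povm_semimeasure K E sigma k.
Let P k := povm_semimeasure K E (emx_val R rho) k.
Let nu k j := emx_val R (emx_scale (pair_scale rho (E k) j) (E k)).
Let q k j := w1 ++ enc_nat k ++ enc_nat j.

Lemma semimeasure_ge0 (B : 'M[R[i]]_(2 ^ n)) k : psd B -> 0 <= povm_semimeasure K E B k.
Proof.
move=> pB; rewrite /povm_semimeasure; case: ifPn => // Kk.
by case: (trace_real (psd_E Kk) pB).
Qed.

Lemma scaled_trace (B : 'M[R[i]]_(2 ^ n)) k j : in_len K k ->
  complex.Re (\tr (nu k j *m B)) =
  ratr (pair_scale rho (E k) j) * povm_semimeasure K E B k.
Proof.
move=> Kk; rewrite /nu emx_val_scale -scalemxAl mxtraceZ /povm_semimeasure Kk.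
by case: (\tr _) => a b /=; rewrite mul0r subr0.
Qed.

Lemma ratr_pair_scale k j : in_len K k ->
  ratr (pair_scale rho (E k) j) = if 0 < P k then (P k)^-1 else (2 ^+ j : R).
Proof.
move=> Kk; rewrite /pair_scale /P /povm_semimeasure Kk trace_entries // ltr0q.
by case: ifP => _; rewrite ?fmorphV // ratr_nat natrX.
Qed.

Lemma nu_test k j : in_len K k -> tests U y (emx_val R rho) (nu k j).
Proof.
move=> Kk; split; first by exists (q k j); exact: (lower_computes_scale rho j w1P Kk (psd_E Kk)).
have c0 : 0 <= (ratr (pair_scale rho (E k) j) : R).
  by rewrite ler0q ltW // pair_scale_gt0.
have pnu : psd (nu k j) by rewrite /nu emx_val_scale; apply: psd_scale => //; exact: psd_E.
(* The order on [R[i]] compares only numbers with equal imaginary parts, so the trace has to be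
   known to be real. *)
have [_ ->] := trace_real pnu psd_rho.
rewrite -[1]/(1%:C)%C lecR scaled_trace // ratr_pair_scale // -/(P k).
case: ltP => [P0|P0]; first by rewrite mulVf // gt_eqF.
have -> : P k = 0 by apply/eqP; rewrite eq_le P0 semimeasure_ge0.
by rewrite mulr0.
Qed.

Lemma test_ge0 (v : 'M[R[i]]_(2 ^ n)) :
  tests U y (emx_val R rho) v -> 0 <= complex.Re (\tr (v *m sigma)).
Proof.
move=> [[p [A [pA _ AB _]]] _]; exact: (trace_limit_ge0 pA AB psd_sigma).
Qed.

Local Open Scope ereal_scope.

(** The universal sum runs over pairs of a test and a program for it, and [(k, j)] is sent to
    [(nu k j, q k j)]. Injectivity comes from the program alone, since [enc_nat] is
    self-delimiting. *)
Lemma tr_univ_test_ge :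
  \esum_(k in [set: nat]) \esum_(j in [set j : nat | in_len K k])
    (univ_prob R U (cond_tape n y) (q k j) * (complex.Re (\tr (nu k j *m sigma)))%:E)
  <= tr_univ_test U y (emx_val R rho) sigma.
Proof.
pose a (v : 'M[R[i]]_(2 ^ n)) p :=
  univ_prob R U (cond_tape n y) p * (complex.Re (\tr (v *m sigma)))%:E.
have a0 v p : tests U y (emx_val R rho) v -> 0 <= a v p.
  by move=> /test_ge0 v0; rewrite mule_ge0 ?univ_prob_ge0 // lee_fin.
rewrite esum_esum; last first.
  by move=> k j _ /= Kk; apply: a0; exact: nu_test.
apply: (@le_trans _ _ (\esum_(v in tests U y (emx_val R rho))
    \esum_(p in [set p | lower_computes U y p v]) a v p)); last first.
  apply: le_esum => v /test_ge0 v0; apply: esumMr_le => // p.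
  exact: univ_prob_ge0.
rewrite esum_esum; last by move=> v p tv _; exact: a0.
apply: (@inj_esum_le _ _ _ _ _ (fun kj => (nu kj.1 kj.2, q kj.1 kj.2)) (fun vp => a vp.1 vp.2)).
- move=> [k j] [k' j'] _ _ [_ /eqP]; rewrite eqseq_cat // eqxx /=.
  have encK (b b' : nat) s s' : enc_nat b ++ s = enc_nat b' ++ s' -> b = b' /\ s = s'.
    elim: b b' => [|b IH] [|b'] //=; first by case=> ->.
    by case=> /IH[-> ->].
  move=> /eqP /encK[-> /(congr1 (cat^~ [::]))].
  by move=> /encK[-> _].
- move=> [k j] [_ /= Kk]; split; first exact: nu_test.
  exact: (lower_computes_scale rho _ w1P Kk (psd_E Kk)).
- by move=> [v p] [/= tv _]; exact: a0.
Qed.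

Lemma semimeasure_term_le k :
  (gam k)%:E * univ_prob R U y (enc_nat k) * ((P k)%:E)^-1
    * ((2^-1 : R) ^+ (size w2).+1)%:E <=
  \esum_(j in [set j : nat | in_len K k])
    (univ_prob R U (cond_tape n y) (q k j) * (complex.Re (\tr (nu k j *m sigma)))%:E).
Proof.
have [Kk|nKk] := boolP (in_len K k); last first.
  rewrite /gam /povm_semimeasure (negPf nKk) !mul0e.
  exact: esum_ge0.
have -> : [set j : nat | true] = [set: nat] by apply/seteqP; split.
have g0 : (0 <= gam k)%R by exact: semimeasure_ge0.
have P0 : (0 <= P k)%R by exact: semimeasure_ge0.
set m := univ_prob R U y (enc_nat k).
have m0 : 0 <= m by exact: univ_prob_ge0.
have b j : m * ((2^-1 : R) ^+ (size w2 + j.+1))%:E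
    * (ratr (pair_scale rho (E k) j) * gam k)%:E <=
    univ_prob R U (cond_tape n y) (q k j) * (complex.Re (\tr (nu k j *m sigma)))%:E.
  rewrite scaled_trace // -/(gam k); apply: lee_wpmul2r; last exact: univ_prob_relay.
  by rewrite lee_fin mulr_ge0 // ler0q ltW // pair_scale_gt0.
apply: le_trans (le_esum (fun j _ => b j)).
have t0 j : 0 <= m * ((2^-1 : R) ^+ (size w2 + j.+1))%:E
    * (ratr (pair_scale rho (E k) j) * gam k)%:E.
  rewrite !mule_ge0 // lee_fin ?exprn_ge0 ?invr_ge0 //.
  by rewrite mulr_ge0 // ler0q ltW // pair_scale_gt0.
(* If the trace is positive, the single term [j = 0] suffices. *)
have [Pp|Pn] := ltP 0%R (P k).
  apply: (@le_trans _ _ (\esum_(j in [set 0%N]) (m * ((2^-1 : R) ^+ (size w2 + j.+1))%:E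
    * (ratr (pair_scale rho (E k) j) * gam k)%:E))); last exact: subset_esum.
  rewrite esum_set1 // ratr_pair_scale // Pp addn1 inver gt_eqF //.
  rewrite [X in X <= _](_ : _ = m * ((2^-1 : R) ^+ (size w2).+1)%:E * ((P k)^-1 * gam k)%:E) //.
  rewrite [(gam k)%:E * m]muleC -!muleA -!EFinM; congr (_ * _%:E).
  by rewrite mulrA [RHS]mulrC [(gam k * _)%R]mulrC.
(* Now [(P k)^-1] is [+oo]: the left side is 0 if [gam k] or [m] is 0, and otherwise the right side
   has to diverge. *)
have Pz : P k = 0%R by apply/eqP; rewrite eq_le Pn.
have [gz|gn] := eqVneq (gam k) 0%R.
  by rewrite {1}gz !mul0e; apply: esum_ge0 => j _; exact: t0.
have [mz|mn] := eqVneq m 0.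
  by rewrite {1}mz mule0 !mul0e; apply: esum_ge0 => j _; exact: t0.
(* The factor [2 ^ j] of the matrix offsets the cost [2^-j] of writing [j], so the lower bounds are
   one positive constant for all [j]. *)
rewrite (eq_esum (b := fun=> m * ((2^-1 : R) ^+ (size w2).+1 * gam k)%:E)); last first.
  move=> j _; rewrite ratr_pair_scale // Pz ltxx -muleA -EFinM; congr (_ * _%:E).
  rewrite addnS -addSn exprD -!mulrA; congr (_ * _)%R.
  by rewrite mulrA -exprMn mulVf // expr1n mul1r.
rewrite esum_cst_infty ?leey //; apply: mule_gt0; first by rewrite lt0e mn.
by rewrite lte_fin mulr_gt0 ?exprn_gt0 ?invr_gt0 // lt0r gn.
Qed.

Lemma deficiency_le :
  classical_deficiency U y gam P <=
  quantum_deficiency U y sigma (emx_val R rho) + (size w2).+1%:R%:E.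
Proof.
apply: log2e_le.
  apply: esum_ge0 => k _; rewrite !mule_ge0 ?univ_prob_ge0 ?inve_ge0 ?lee_fin //;
  exact: semimeasure_ge0.
rewrite -esumMr; last 2 first.
- by rewrite exprn_gt0 // invr_gt0.
- by move=> k; rewrite !mule_ge0 ?univ_prob_ge0 ?inve_ge0 ?lee_fin //; exact: semimeasure_ge0.
by apply: le_trans tr_univ_test_ge; apply: le_esum => k _; exact: semimeasure_term_le.
Qed.

End Bound.
End Deficiency.

Local Open Scope ring_scope.

Theorem theorem8 (R : realType) (U : machine) (U_univ : universal U) :
  exists c : R,
    forall (n : nat) (rho : emx n) (K : option nat) (E : nat -> emx n)
           (sigma : 'M[R[i]]_(2 ^ n)),
      semi_density (emx_val R rho) ->
      semi_density sigma ->
      elementary_povm R U K E ->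
      let y := rel_tape rho K E in
      (classical_deficiency U y (povm_semimeasure K E sigma)
                                (povm_semimeasure K E (emx_val R rho))
       <= quantum_deficiency U y sigma (emx_val R rho) + c%:E)%E.
Proof.
have [w1 w1P] := U_univ scaled_povm.
have [w2 w2P] := U_univ (relay U w1).
exists (size w2).+1%:R => n rho K E sigma [prho _] [psigma _] [[pE _] _].
exact: (deficiency_le w1P w2P).
Qed.
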